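(* Let $\mathfrak{g}=\bigoplus_{i\in\mathbb{N}}\mathfrak{g}_i$ be an infinite-dimensional $\mathbb{N}$-graded Lie algebra of maximal class and suppose $\mathfrak{g}=\langle\mathfrak{g}_1,\mathfrak{g}_3\rangle$ (that is, $\mathfrak{g}$ is generated as a Lie algebra by $\mathfrak{g}_1$ and $\mathfrak{g}_3$). Then one of the following holds: (1) $\mathfrak{g}\cong\mathfrak{m}_0^3$; (2) $\mathfrak{g}\cong\mathfrak{m}_3$; (3) $\mathfrak{g}\cong W^3$.
   Context: All Lie algebras are over an algebraically closed field $F$ of characteristic zero. For a Lie algebra $\mathfrak{g}$ with lower central series $\mathfrak{g}^1=\mathfrak{g}\supseteq\mathfrak{g}^2\supseteq\cdots$, $\mathfrak{g}$ is residually nilpotent if $\bigcap_i\mathfrak{g}^i=0$; a residually nilpotent Lie algebra is of maximal class if $\sum_{i\ge1}(\dim\mathfrak{g}^i/\mathfrak{g}^{i+1}-1)=1$. The three Lie algebras have basis $e_1,e_3,e_4,e_5,\dots$ and the following brackets (unlisted brackets of basis elements, up to skew-symmetry, are zero): - $\mathfrak{m}_0^3$: $[e_1,e_i]=e_{i+1}$ for $i\ge 3$; - $\mathfrak{m}_3$: $[e_1,e_i]=e_{i+1}$ for $i\ge3$, and $[e_3,e_i]=e_{3+i}$ for $i\ge4$; - $W^3$: $[e_i,e_j]=(j-i)e_{i+j}$ for all $i,j\in\{1,3,4,5,\dots\}$. *)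

(* Defs.v *)
From HB Require Import structures.
From mathcomp Require Import all_boot all_order all_algebra.
From mathcomp Require Import zify ring.
From mathcomp Require Import boolp classical_sets.

Set Implicit Arguments.
Unset Strict Implicit.
Unset Printing Implicit Defensive.

Import Order.TTheory GRing.Theory Num.Theory.

Local Open Scope classical_set_scope.
Local Open Scope ring_scope.

HB.mixin Record Lmodule_isLie (F : fieldType) L & GRing.Lmodule F L := {
  lie : L -> L -> L;
  lie_linearl : forall y, linear (fun x => lie x y);
  lie_linearr : forall x, linear (lie x);
  liexx : forall x, lie x x = 0;
  lie_jacobi : forall x y z,
    lie x (lie y z) + lie y (lie z x) + lie z (lie x y) = 0
}.

#[short(type="lieAlgType")]
HB.structure Definition LieAlgebra (F : fieldType) :=
  {L of Lmodule_isLie F L & GRing.Lmodule F L}.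

Definition lie_iso (F : fieldType) (L M : lieAlgType F) : Prop :=
  exists f : {linear L -> M},
    bijective f /\ forall x y : L, f (lie x y) = lie (f x) (f y).

Section LieNotions.
Variables (F : fieldType) (L : lieAlgType F).
Implicit Types A U V : set L.

Definition subspace A : Prop := GRing.submod_closed [in A].

Definition lie_subalgebra A : Prop :=
  subspace A /\ forall x y, A x -> A y -> A (lie x y).

Definition generates A : Prop := smallest lie_subalgebra A = setT.

(* Indices are shifted: [lcs i] is the term usually written g^(i+1), so that
   [lcs 0] is the whole algebra. *)
Fixpoint lcs (i : nat) : set L :=
  if i is i'.+1 then smallest subspace [set lie x y | x in setT & y in lcs i']
  else setT.

(* dim (U / V) = d, for subspaces V of U: the classes modulo V of some d vectors
   of U form a basis of U / V. *)
Definition quotient_dim U V (d : nat) : Prop :=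
  V `<=` U /\
  exists v : 'I_d -> L, (forall k, U (v k)) /\
    forall x, U x -> exists! c : 'rV[F]_d, V (x - \sum_k c 0 k *: v k).

Definition infinite_dimensional : Prop :=
  forall d, ~ quotient_dim setT [set 0] d.

Definition residually_nilpotent : Prop := \bigcap_i lcs i = [set 0].

(* The sum over all i >= 1 of the integers dim (g^i / g^(i+1)) - 1 converges
   exactly when its partial sums are eventually constant. *)
Definition maximal_class : Prop :=
  residually_nilpotent /\
  exists d : nat -> nat,
    (forall i, quotient_dim (lcs i) (lcs i.+1) (d i)) /\
    exists N, forall n, (N <= n)%N -> \sum_(i < n) ((d i)%:Z - 1) = 1.

(* The degrees are the positive integers: the component of index 0 is null. *)
Record positive_grading (gr : nat -> set L) : Prop := PositiveGrading {
  grading0 : gr 0%N = [set 0];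
  grading_subspace : forall i, subspace (gr i);
  grading_lie : forall i j x y, gr i x -> gr j y -> gr (i + j)%N (lie x y);
  grading_span : forall x, exists n (y : nat -> L),
    (forall i, gr i (y i)) /\ x = \sum_(i < n) y i;
  grading_direct : forall n (y : nat -> L), (forall i, gr i (y i)) ->
    \sum_(i < n) y i = 0 -> forall i, (i < n)%N -> y i = 0
}.

End LieNotions.

(* Lie algebras with basis e_1, e_3, e_4, e_5, ... and brackets
   [e_i, e_j] = c(i, j) e_(i+j) for an integer table c.  Only the values of c at
   indices of basis vectors matter; as c(1, 1) = 0, the missing index 2 = 1 + 1
   never arises. *)
Definition basis_index (i : nat) : bool := (i == 1)%N || (3 <= i)%N.

Record lie_table := LieTable {
  table_coef :> nat -> nat -> int;
  table_alt : forall i, basis_index i -> table_coef i i = 0;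
  table_skew : forall i j, basis_index i -> basis_index j ->
    table_coef j i = - table_coef i j;
  table_jacobi : forall i j k,
    basis_index i -> basis_index j -> basis_index k ->
    table_coef j k * table_coef i (j + k)
    + table_coef k i * table_coef j (k + i)
    + table_coef i j * table_coef k (i + j) = 0
}.

(* The underlying space is that of polynomials: 'X^0 stands for e_1, and 'X^k
   for e_(k+2) when k > 0. *)
Definition table_algebra (F : fieldType) (c : lie_table) : Type := {poly F}.

HB.instance Definition _ (F : fieldType) (c : lie_table) :=
  GRing.Lmodule.copy (table_algebra F c) {poly F}.

Definition degree_of (k : nat) : nat := if k is k'.+1 then k'.+3 else 1.

Definition basis_vector (F : fieldType) (c : lie_table) (i : nat) :
  table_algebra F c := 'X^(i - 2).

Section TableAlgebra.
Variables (F : fieldType) (c : lie_table).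
Local Notation V := (table_algebra F c).
Local Notation e := (basis_vector F c).
Implicit Types p q r : {poly F}.

Definition table_bracket (p q : V) : V :=
  \sum_(k < size (p : {poly F})) \sum_(l < size (q : {poly F}))
    ((p : {poly F})`_k * (q : {poly F})`_l
     * (c (degree_of k) (degree_of l))%:~R)
    *: e (degree_of k + degree_of l).

Local Notation B := table_bracket.

Lemma basis_index_degree k : basis_index (degree_of k).
Proof. by case: k. Qed.

Lemma degree_ofK k : (degree_of k - 2)%N = k.
Proof. by case: k => //= k; rewrite -addn2 addnK. Qed.

Lemma degree_of_index i : basis_index i -> degree_of (i - 2) = i.
Proof. by case: i => [|[|[|i]]]. Qed.

Lemma table_bracketE n p q : (size p <= n)%N -> (size q <= n)%N ->
  B p q = \sum_(k < n) \sum_(l < n)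
    (p`_k * q`_l * (c (degree_of k) (degree_of l))%:~R)
    *: e (degree_of k + degree_of l).
Proof.
move=> pn qn; rewrite /B (big_ord_widen n (fun k => \sum_(l < size q)
    (p`_k * q`_l * (c (degree_of k) (degree_of l))%:~R)
    *: e (degree_of k + degree_of l))) // big_mkcond; apply: eq_bigr => k _.
rewrite (big_ord_widen n (fun l =>
    (p`_k * q`_l * (c (degree_of k) (degree_of l))%:~R)
    *: e (degree_of k + degree_of l))) // big_mkcond.
case: ltnP => [kp|pk].
  apply: eq_bigr => l _; case: ltnP => // ql.
  by rewrite (nth_default 0 ql) mulr0 mul0r scale0r.
rewrite big1 // => l _.
by rewrite (nth_default 0 pk) !mul0r scale0r.
Qed.

Lemma table_bracket_linearl q : linear (fun p : V => B p q).
Proof.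
move=> a p p'; set n := maxn (size (q : {poly F}))
  (maxn (size (p : {poly F})) (size (p' : {poly F}))).
have qn : (size (q : {poly F}) <= n)%N by rewrite leq_maxl.
have pn : (size (p : {poly F}) <= n)%N by rewrite /n !leq_max leqnn orbT.
have p'n : (size (p' : {poly F}) <= n)%N by rewrite /n !leq_max leqnn !orbT.
have sn : (size (a *: (p : {poly F}) + (p' : {poly F}))%R <= n)%N.
  apply: leq_trans (size_polyD _ _) _; rewrite geq_max p'n andbT.
  exact: leq_trans (size_scale_leq _ _) pn.
rewrite (table_bracketE sn qn) (table_bracketE pn qn) (table_bracketE p'n qn).
rewrite scaler_sumr -big_split; apply: eq_bigr => k _ /=.
rewrite scaler_sumr -big_split; apply: eq_bigr => l _ /=.
by rewrite scalerA -scalerDl coefD coefZ !mulrDl !mulrA.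
Qed.

Lemma table_bracketC p q : B p q = - B q p.
Proof.
set n := maxn (size p) (size q).
have pn : (size p <= n)%N by rewrite leq_maxl.
have qn : (size q <= n)%N by rewrite leq_maxr.
rewrite (table_bracketE pn qn) (table_bracketE qn pn) exchange_big -sumrN.
apply: eq_bigr => k _; rewrite -sumrN; apply: eq_bigr => l _ /=.
rewrite (table_skew c (basis_index_degree k) (basis_index_degree l)).
by rewrite rmorphN /= mulrN scaleNr addnC (mulrC q`_k).
Qed.

Lemma table_bracket_linearr p : linear (B p).
Proof.
move=> a q q'.
rewrite table_bracketC (table_bracket_linearl p a q q').
by rewrite (table_bracketC p q) (table_bracketC p q') scalerN opprD.
Qed.

Lemma table_bracketXn k l :
  B 'X^k 'X^l = (c (degree_of k) (degree_of l))%:~R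
    *: e (degree_of k + degree_of l).
Proof.
rewrite (@table_bracketE (maxn k.+1 l.+1)) ?size_polyXn ?leq_maxl ?leq_maxr //.
have kn : (k < maxn k.+1 l.+1)%N by rewrite leq_maxl.
have ln : (l < maxn k.+1 l.+1)%N by rewrite leq_maxr.
rewrite (bigD1 (Ordinal kn)) //= (bigD1 (Ordinal ln)) //= !coefXn !eqxx !mul1r.
rewrite big1 ?addr0 => [|j nj]; last first.
  rewrite coefXn; have /negPf -> : (j != l :> nat)%N by [].
  by rewrite mulr0 mul0r scale0r.
rewrite big1 ?addr0 // => i ni; rewrite big1 // => j _.
rewrite coefXn; have /negPf -> : (i != k :> nat)%N by [].
by rewrite !mul0r scale0r.
Qed.

Lemma basis_bracket i j : basis_index i -> basis_index j ->
  B (e i) (e j) = (c i j)%:~R *: e (i + j).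
Proof. by move=> bi bj; rewrite table_bracketXn !degree_of_index. Qed.

Lemma basis_bracket_sum i j k : basis_index i -> basis_index j ->
    basis_index k ->
  (c j k)%:~R *: B (e i) (e (j + k))
  = (c j k * c i (j + k))%:~R *: e (i + (j + k)).
Proof.
move=> bi bj bk; have [bjk|bjk] := boolP (basis_index (j + k)).
  by rewrite basis_bracket // scalerA rmorphM.
have [-> ->] : j = 1%N /\ k = 1%N by move: bj bk bjk; rewrite /basis_index; lia.
by rewrite (@table_alt c 1) // mul0r !scale0r.
Qed.

Lemma linear_Xn_eq0 (f : V -> V) : linear f -> (forall k, f 'X^k = 0) ->
  forall p : V, f p = 0.
Proof.
move=> lf f0 p; have f00 : f 0 = 0.
  by have := lf (-1) 0 0; rewrite scaler0 add0r scaleN1r addNr.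
rewrite -[p : {poly F}]coefK poly_def.
elim: (size _) => [|n IHn]; first by rewrite big_ord0.
by rewrite big_ord_recr /= addrC lf f0 scaler0 add0r IHn.
Qed.

Lemma table_bracketZ a (p q : V) : B p (a *: q) = a *: B p q.
Proof.
have Bp0 : B p 0 = 0.
  have := table_bracket_linearr p (-1) 0 0.
  by rewrite scaler0 add0r scaleN1r addNr.
by have := table_bracket_linearr p a q 0; rewrite Bp0 !addr0.
Qed.

Lemma table_bracket_jacobi (p q r : V) :
  B p (B q r) + B q (B r p) + B r (B p q) = 0.
Proof.
pose J x y z := B x (B y z) + B y (B z x) + B z (B x y).
have cyc x y z : J x y z = J y z x by rewrite /J -addrA addrC.
have lin y z : linear (fun x => J x y z).
  move=> a x x'; rewrite /J (table_bracket_linearl (B y z) a x x').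
  rewrite (table_bracket_linearr z a x x') (table_bracket_linearl y a x x').
  rewrite (table_bracket_linearr y) (table_bracket_linearr z) !scalerDr.
  rewrite (addrACA (a *: B x _ + a *: B y _)) (addrACA (a *: B x _)).
  by [].
rewrite -/(J p q r); move: p; apply: (linear_Xn_eq0 (f := fun x => J x q r)) => // k.
rewrite cyc; move: q; apply: (linear_Xn_eq0 (f := fun x => J x r 'X^k)) => // l.
rewrite cyc; move: r; apply: (linear_Xn_eq0 (f := fun x => J x 'X^k 'X^l)) => // m.
rewrite /J !table_bracketXn !table_bracketZ.
have eE j : 'X^j = e (degree_of j) by rewrite /basis_vector degree_ofK.
rewrite !eE !basis_bracket_sum ?basis_index_degree //.
set i1 := degree_of k; set i2 := degree_of l; set i3 := degree_of m.
have -> : (i1 + (i2 + i3) = i3 + (i1 + i2))%N by lia.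
have -> : (i2 + (i3 + i1) = i3 + (i1 + i2))%N by lia.
rewrite -!scalerDl -!rmorphD /=.
have /= := @table_jacobi c i3 i1 i2 (basis_index_degree m)
  (basis_index_degree k) (basis_index_degree l).
by move=> ->; rewrite scale0r.
Qed.

Lemma table_bracketxx (p : V) : B p p = 0.
Proof.
rewrite -[p : {poly F}]coefK poly_def.
elim: (size _) => [|n IHn].
  by rewrite big_ord0 /B size_poly0 big_ord0.
rewrite big_ord_recr /= addrC; set s := \sum_(i < n) _ in IHn *.
set a := (_`_n); rewrite (table_bracket_linearl _ a 'X^n s).
rewrite (table_bracket_linearr 'X^n a 'X^n s).
rewrite (table_bracket_linearr s a 'X^n s) IHn addr0.
rewrite table_bracketXn table_alt ?basis_index_degree // scale0r scaler0 add0r.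
by rewrite -scalerDr (table_bracketC s) addrN scaler0.
Qed.

HB.instance Definition _ := @Lmodule_isLie.Build F V table_bracket
  table_bracket_linearl table_bracket_linearr table_bracketxx
  table_bracket_jacobi.

Lemma lie_basis_vector i j : basis_index i -> basis_index j ->
  lie (e i) (e j) = (c i j)%:~R *: e (i + j).
Proof. exact: basis_bracket. Qed.

End TableAlgebra.

(* The skew-symmetric table with coefficient 1 at the pairs (i, j) listed by h. *)
Definition skew_coef (h : rel nat) (i j : nat) : int := (h i j)%:Z - (h j i)%:Z.

Definition m03_coef : nat -> nat -> int :=
  skew_coef (fun i j => (i == 1)%N && (3 <= j)%N).

Definition m3_coef : nat -> nat -> int :=
  skew_coef (fun i j => (i == 1)%N && (3 <= j)%N || (i == 3)%N && (4 <= j)%N).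

Definition W3_coef (i j : nat) : int := j%:Z - i%:Z.

Lemma skew_coefxx h i : skew_coef h i i = 0.
Proof. exact: subrr. Qed.

Lemma skew_coefC h i j : skew_coef h j i = - skew_coef h i j.
Proof. by rewrite /skew_coef opprB. Qed.

Lemma m03_jacobi i j k : basis_index i -> basis_index j -> basis_index k ->
  m03_coef j k * m03_coef i (j + k) + m03_coef k i * m03_coef j (k + i)
  + m03_coef i j * m03_coef k (i + j) = 0.
Proof.
rewrite /m03_coef /skew_coef.
by case: i => [|[|[|i]]]; case: j => [|[|[|j]]]; case: k => [|[|[|k]]];
  rewrite //= ?addSn ?addnS ?add0n ?addn0 //=; lia.
Qed.

Lemma m3_jacobi i j k : basis_index i -> basis_index j -> basis_index k ->
  m3_coef j k * m3_coef i (j + k) + m3_coef k i * m3_coef j (k + i)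
  + m3_coef i j * m3_coef k (i + j) = 0.
Proof.
rewrite /m3_coef /skew_coef.
by case: i => [|[|[|[|i]]]]; case: j => [|[|[|[|j]]]];
  case: k => [|[|[|[|k]]]];
  rewrite //= ?addSn ?addnS ?add0n ?addn0 //=; lia.
Qed.

Lemma W3_coefxx i : W3_coef i i = 0.
Proof. exact: subrr. Qed.

Lemma W3_coefC i j : W3_coef j i = - W3_coef i j.
Proof. by rewrite /W3_coef opprB. Qed.

Lemma W3_jacobi i j k :
  W3_coef j k * W3_coef i (j + k) + W3_coef k i * W3_coef j (k + i)
  + W3_coef i j * W3_coef k (i + j) = 0.
Proof. by rewrite /W3_coef !PoszD; ring. Qed.

Definition m03_table : lie_table :=
  LieTable (fun i _ => skew_coefxx _ i) (fun i j _ _ => skew_coefC _ i j)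
    m03_jacobi.

Definition m3_table : lie_table :=
  LieTable (fun i _ => skew_coefxx _ i) (fun i j _ _ => skew_coefC _ i j)
    m3_jacobi.

Definition W3_table : lie_table :=
  LieTable (fun i _ => W3_coefxx i) (fun i j _ _ => W3_coefC i j)
    (fun i j k _ _ _ => W3_jacobi i j k).

Definition m03 (F : fieldType) : lieAlgType F := table_algebra F m03_table.
Definition m3 (F : fieldType) : lieAlgType F := table_algebra F m3_table.
Definition W3 (F : fieldType) : lieAlgType F := table_algebra F W3_table.

(* Main.v *)
(** In characteristic zero a Lie algebra of maximal class has generators x, y
    such that y maps each term of the lower central series two steps down: a
    first failure at [v_N = (ad x)^N y] would, by the Jacobi identity in degrees
    N, N + 1 and N + 2, kill the next quotient of the series.  The generators
    can be taken homogeneous, so x, y = v_0 and v_n = (ad x)^n y form a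
    homogeneous basis, and comparing degrees gives [v_0, v_n] = a_n v_(n+3).
    (If x and y have degrees other than 1 and 3, then a = 0; this covers m_0^3
    with a different grading.)

    Then [v_m, v_n] = c(m, n) v_(m+n+3), where c is skew-symmetric and satisfies
    c(m, n) = c(m+1, n) + c(m, n+1), hence is determined by the numbers
    t_k = c(k, k+1).  The Jacobi identity makes all t_k vanish if t_0 = 0.  If
    t_0 = 1, its instances of low degree leave t_1 = 0 or t_1 = 1/7, and those
    of higher degree determine the remaining t_k one after the other: these two
    solutions are m_3 and W^3. *)

From HB Require Import structures.
Require Import Defs.
From mathcomp Require Import all_boot all_order all_algebra.
From mathcomp Require Import boolp classical_sets.
From mathcomp Require Import zify ring.

Set Implicit Arguments.
Unset Strict Implicit.
Unset Printing Implicit Defensive.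

Import GRing.Theory.

Local Open Scope classical_set_scope.
Local Open Scope ring_scope.

(** * Structure constants *)

Section StructureConstants.
Variable F : fieldType.
Implicit Types (c D : nat -> nat -> F) (k m n r : nat).

(* [c m n] stands for the coefficient of [v_m, v_n] = c m n v_(m+n+3), where
   v_(n+1) = [x, v_n]: the recursion is the derivation property of ad x, and
   [jacobi3] the Jacobi identity for v_i, v_j, v_k. *)
Definition pascal c :=
  (forall m n, c n m = - c m n) /\ forall m n, c m n = c m.+1 n + c m n.+1.

Definition jacobi3 c := forall i j k,
  c j k * c i (j + k + 3)%N + c k i * c j (k + i + 3)%N
  + c i j * c k (i + j + 3)%N = 0.

(** With the sign [(-1) ^+ m] factored out, passing from degree [r] to degree [r.+1] is summation of
    [- P], with [c 0 r.+1] as the constant. *)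
Lemma pascal_step c r (P Q : nat -> F) : pascal c ->
  (forall m n, (m + n)%N = r -> c m n = (-1) ^+ m * P m) ->
  Q 0 = c 0 r.+1 -> (forall m, Q m.+1 = Q m - P m) ->
  forall m n, (m + n)%N = r.+1 -> c m n = (-1) ^+ m * Q m.
Proof.
move=> [_ cR] cP Q0 QS; elim=> [|m IHm] n mn.
  by rewrite mul1r Q0 -mn.
have := cR m n; rewrite (cP m n) ?(IHm n.+1); [|lia|lia] => e.
have -> : c m.+1 n = (-1) ^+ m * P m - (-1) ^+ m * Q m by rewrite e addrK.
by rewrite QS exprS; ring.
Qed.

Hypothesis F0 : [pchar F] =i pred0.

Lemma natr_neq0 n : (n != 0)%N -> n%:R != 0 :> F.
Proof. by rewrite (iffLR (pcharf0P _) F0). Qed.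

Lemma pascal_diag c n : pascal c -> c n n = 0.
Proof.
move=> [/(_ n n) cS _]; have := natr_neq0 (isT : 2 != 0)%N.
apply: contraNeq => c0; apply/eqP.
have : 2%:R * c n n = 0 by rewrite mulrDl mul1r {1}cS addNr.
by move/eqP; rewrite mulf_eq0 (negPf c0) orbF => /eqP.
Qed.

Lemma pascal_alternating c r : pascal c ->
  (forall m n, (m + n)%N = r -> c m n = 0) ->
  forall m n, (m + n)%N = r.+1 -> c m n = (-1) ^+ m * c 0 r.+1.
Proof.
move=> cp c0; apply: (@pascal_step c r (fun=> 0)) => // [m n mn|m].
  by rewrite c0 // mulr0.
by rewrite subr0.
Qed.

(** Degree 2k+2 is a constant times [(-1) ^+ m], and its middle entry lies on the diagonal. *)
Lemma pascal_even c k : pascal c ->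
  (forall m n, (m + n)%N = k.*2.+1 -> c m n = 0) ->
  forall m n, (m + n)%N = k.*2.+2 -> c m n = 0.
Proof.
move=> cp c0 m n mn; rewrite (pascal_alternating cp c0) //.
have := pascal_alternating cp c0 (m := k.+1) (n := k.+1).
rewrite (pascal_diag _ cp) => /(_ ltac:(lia)) /esym /eqP.
by rewrite mulf_eq0 signr_eq0 => /eqP ->; rewrite mulr0.
Qed.

(** Two summations starting from zero: up to sign, degree 2k+1 is constant and degree 2k+2 affine in
    [m]. The last equation is skew-symmetry between (0, 2k+2) and (2k+2, 0). *)
Lemma pascal_second c k : pascal c ->
  (forall m n, (m + n)%N = k.*2 -> c m n = 0) ->
  forall m n, (m + n)%N = k.*2.+2 ->
  c m n = (-1) ^+ m * (c 0 k.*2.+2 - m%:R * c 0 k.*2.+1)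
  /\ 2%:R * c 0 k.*2.+2 = k.*2.+2%:R * c 0 k.*2.+1.
Proof.
move=> cp c0.
have c2 m n : (m + n)%N = k.*2.+2 ->
    c m n = (-1) ^+ m * (c 0 k.*2.+2 - m%:R * c 0 k.*2.+1).
  apply: (pascal_step (P := fun=> c 0 k.*2.+1)
      (Q := fun m => c 0 k.*2.+2 - m%:R * c 0 k.*2.+1)) => //.
  - by move=> i j ij; rewrite (pascal_alternating cp c0).
  - by rewrite mul0r subr0.
  - by move=> i; rewrite -natr1; ring.
move=> m n mn; split; first exact: c2.
have := c2 k.*2.+2 0%N (addn0 _); rewrite (cp.1 0%N).
rewrite -signr_odd /= negbK odd_double expr0 mul1r => /eqP.
rewrite eq_sym -subr_eq0 => /eqP e; apply/eqP; rewrite -subr_eq0 -e; apply/eqP.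
by ring.
Qed.

(* The polynomial expression of [c m (m + q)] in the numbers [c k k.+1]. *)
Fixpoint pascal_gap c q m : F :=
  if q is q'.+1 then
    if q' is q''.+1 then pascal_gap c q' m - pascal_gap c q'' m.+1
    else c m m.+1
  else 0.

Definition pascal_val c m n : F :=
  if (m <= n)%N then pascal_gap c (n - m) m else - pascal_gap c (m - n) n.

(** The recursion is solved for the entry farthest from the diagonal. At numerical indices
    [pascal_val] simplifies, which turns instances of the Jacobi identity into explicit polynomial
    relations. *)
Lemma pascal_valE c m n : pascal c -> c m n = pascal_val c m n.
Proof.
move=> cp; have gapE q i : c i (i + q)%N = pascal_gap c q i
    /\ c i (i + q.+1)%N = pascal_gap c q.+1 i.
  elim: q i => [|q IHq] i; first by rewrite addn0 addn1 (pascal_diag _ cp).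
  split; first by case: (IHq i).
  have [_ /= <-] := IHq i; have [<- _] := IHq i.+1.
  by rewrite addSnnS [c i (i + q.+1)%N](cp.2 i) -addnS addrAC subrr add0r.
rewrite /pascal_val; case: leqP => [mn|/ltnW nm].
  by rewrite -(gapE _ _).1 subnKC.
by rewrite cp.1 -(gapE _ _).1 subnKC.
Qed.

(** By induction on the degree, each antidiagonal is a constant times [(-1) ^+ m]. A middle entry
    vanishes: some t_j in odd degree, a diagonal entry in even degree. *)
Lemma pascal_vanish c k : pascal c -> (forall j, (j < k)%N -> c j j.+1 = 0) ->
  forall m n, (m + n <= k.*2)%N -> c m n = 0.
Proof.
move=> cp t0 m n; move: {-1}(m + n)%N (erefl (m + n)%N) => r.
elim: r m n => [|r IHr] m n mn rk.
  have [-> ->] : m = 0%N /\ n = 0%N by lia.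
  exact: pascal_diag.
have c0 i j : (i + j)%N = r -> c i j = 0 by move=> ij; apply: IHr => //; lia.
have [rodd|reven] := boolP (odd r).
  have re : r = (r./2).*2.+1 by rewrite -{1}(odd_double_half r) rodd.
  by apply: (pascal_even cp (k := r./2)); rewrite -?re // mn re.
have re : r = (r./2).*2 by rewrite -{1}(odd_double_half r) (negPf reven).
rewrite (pascal_alternating cp c0) //.
have := pascal_alternating cp c0 (m := r./2) (n := r./2.+1) ltac:(lia).
rewrite t0; last by lia.
by move=> /esym/eqP; rewrite mulf_eq0 signr_eq0 => /eqP ->; rewrite mulr0.
Qed.

(* If t_k is the first nonzero t, then the Jacobi identity for l, k, k+1 with
   l < 3 <= k gives c(l, 2k+4) = 0.  The skew-symmetry of c in the degrees 2k+2,
   2k+4 and 2k+6, computed from the recursion, is then inconsistent. *)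
Lemma jacobi3_vanish_large c k : pascal c -> jacobi3 c -> (2 < k)%N ->
  (forall j, (j < k)%N -> c j j.+1 = 0) -> c k k.+1 = 0.
Proof.
move=> cp cJ k2 t0; have c0 := pascal_vanish cp t0.
apply/eqP/negPn/negP => tn0.
have cl l : (l < 3)%N -> c l k.*2.+4 = 0.
  move=> l3; have := cJ l k k.+1.
  rewrite (c0 k.+1 l); last by lia.
  rewrite (c0 l k); last by lia.
  have -> : (k + k.+1 + 3 = k.*2.+4)%N by lia.
  rewrite !mul0r !addr0 => /eqP; rewrite mulf_eq0 (negPf tn0) => /eqP; exact.
have cS m n : c m n.+1 = c m n - c m.+1 n by rewrite (cp.2 m n) addrC addKr.
have x3 : c 0 k.*2.+4 = 0 by exact: cl.
have x4 : c 0 k.*2.+1.+4 = 0 by rewrite cS !cl // subrr.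
have x5 : c 0 k.*2.+2.+4 = 0 by rewrite cS x4 cS !cl // !subrr.
pose y0 := c 0 k.*2.+1; pose y1 := c 0 k.*2.+2; pose y2 := c 0 k.*2.+3.
have n2 := natr_neq0 (isT : 2 != 0)%N; have n3 := natr_neq0 (isT : 3 != 0)%N.
have n5 := natr_neq0 (isT : 5 != 0)%N.
(* Up to sign, [Qi] gives [c] in degree 2k+1+i: it is the i-fold sum of [y0] with constants [y1],
   [y2], then 0 three times. Its coefficients are signed binomials in [m]. *)
pose Q1 m : F := y1 - m%:R * y0.
pose Q2 m : F := y2 - m%:R * y1 + m%:R * (m%:R - 1) / 2 * y0.
pose Q3 m : F := - m%:R * y2 + m%:R * (m%:R - 1) / 2 * y1
  - m%:R * (m%:R - 1) * (m%:R - 2) / 6 * y0.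
pose Q4 m : F := m%:R * (m%:R - 1) / 2 * y2
  - m%:R * (m%:R - 1) * (m%:R - 2) / 6 * y1
  + m%:R * (m%:R - 1) * (m%:R - 2) * (m%:R - 3) / 24 * y0.
pose Q5 m : F := - (m%:R * (m%:R - 1) * (m%:R - 2) / 6) * y2
  + m%:R * (m%:R - 1) * (m%:R - 2) * (m%:R - 3) / 24 * y1
  - m%:R * (m%:R - 1) * (m%:R - 2) * (m%:R - 3) * (m%:R - 4) / 120 * y0.
have h0 : forall m n, (m + n)%N = k.*2.+1 -> c m n = (-1) ^+ m * y0.
  by apply: pascal_alternating => // m n mn; apply: c0; rewrite mn.
have h1 : forall m n, (m + n)%N = k.*2.+2 -> c m n = (-1) ^+ m * Q1 m.
  apply: (pascal_step (P := fun=> y0)) => // [|m]; rewrite /Q1.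
    by rewrite mul0r subr0.
  by rewrite -natr1; ring.
have h2 : forall m n, (m + n)%N = k.*2.+3 -> c m n = (-1) ^+ m * Q2 m.
  apply: (pascal_step (P := Q1)) => // [|m]; rewrite /Q2 /Q1.
    by rewrite !mul0r subr0 addr0.
  by rewrite -natr1; field.
have h3 : forall m n, (m + n)%N = k.*2.+4 -> c m n = (-1) ^+ m * Q3 m.
  apply: (pascal_step (P := Q2)) => // [|m]; rewrite /Q3 /Q2.
    by rewrite x3; ring.
  by rewrite -natr1; field; rewrite !natr_neq0.
have h4 : forall m n, (m + n)%N = k.*2.+1.+4 -> c m n = (-1) ^+ m * Q4 m.
  apply: (pascal_step (P := Q3)) => // [|m]; rewrite /Q4 /Q3.
    by rewrite x4; ring.
  by rewrite -natr1; field; rewrite !natr_neq0.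
have h5 : forall m n, (m + n)%N = k.*2.+2.+4 -> c m n = (-1) ^+ m * Q5 m.
  apply: (pascal_step (P := Q4)) => // [|m]; rewrite /Q5 /Q4.
    by rewrite x5; ring.
  by rewrite -natr1; field; rewrite !natr_neq0.
have e1 := h1 k.*2.+2 0%N (addn0 _); have e3 := h3 k.*2.+4 0%N (addn0 _).
have e5 := h5 k.*2.+2.+4 0%N (addn0 _).
move: e1 e3 e5; rewrite !(cp.1 0%N) x3 x5 oppr0 -/y1.
have ev j : (-1) ^+ j.*2 = 1 :> F by rewrite -signr_odd odd_double.
rewrite (ev k.+1) (ev k.+2) (ev k.+3) !mul1r => e1 e3 e5.
have y1E : y1 = k.+1%:R * y0.
  apply: (mulfI n2); apply/eqP; rewrite -subr_eq0; apply/eqP.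
  transitivity (Q1 k.*2.+2 - - y1); last by rewrite -e1 subrr.
  by rewrite /Q1 -mul2n -!natr1; ring.
have kE j : (k.*2 + j)%:R = 2 * k%:R + j%:R :> F by rewrite natrD -mul2n natrM.
(* This combination of the relations in degrees 2k+4 and 2k+6 eliminates [y2]; since [y1] is a
   multiple of [y0], only a multiple of [y0] remains. The factor 720 clears denominators. *)
have : ((k.*2 + 2) * (k.*2 + 3) * (k.*2 + 4) * (k.*2 + 5) * (k.*2 + 6))%:R * y0
    = 0.
  have <- : 720 * ((k.*2 + 6)%:R * (k.*2 + 5)%:R / 6 * Q3 k.*2.+4
      - Q5 k.*2.+2.+4) = 0 by rewrite -e3 -e5; ring.
  have -> : k.*2.+2.+4 = (k.*2 + 6)%N by lia.
  have -> : k.*2.+4 = (k.*2 + 4)%N by lia.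
  rewrite /Q3 /Q5 y1E !natrM !kE -natr1; field.
  by rewrite !natr_neq0.
have := h0 k k.+1 ltac:(lia) => tE.
move/eqP; rewrite mulf_eq0 (negPf (natr_neq0 _)) /=; last by lia.
by move/eqP => y00; rewrite tE y00 mulr0 eqxx in tn0.
Qed.

(** These four triples have degree low enough to involve only t_0, ..., t_4. The first three
    relations are linear in [d], [f] and [h] in turn; the fourth is then a condition on [a] and
    [b]. *)
Lemma jacobi3_relations c (a := c 0 1) (b := c 1 2) (d := c 2 3) (f := c 3 4)
    (h := c 4 5) : pascal c -> jacobi3 c ->
  [/\ 3 * d * (a + b) = 4 * b ^+ 2,
      f * (3 * a - 2 * b - 4 * d) = 5 * b * d - 10 * d ^+ 2,
      h * (2 * b + d) = 4 * b * f + 6 * d * f - 5 * d ^+ 2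
    & 21 * d * f - 20 * f ^+ 2 + 5 * f * h + 3 * a * h - 5 * b * h - 6 * b * f
      = 0].
Proof.
move=> cp cJ; split; [move: (cJ 0 1 2) | move: (cJ 0 2 3) | move: (cJ 1 2 3)
  | move: (cJ 0 3 4)]; rewrite !(pascal_valE _ _ cp) /pascal_val /=
  -/a -/b -/d -/f -/h => e.
- by apply/eqP; rewrite -subr_eq0; apply/eqP; rewrite -[RHS]e; ring.
- by apply/eqP; rewrite -subr_eq0; apply/eqP; rewrite -[RHS]e; ring.
- by apply/eqP; rewrite -subr_eq0 -oppr_eq0; apply/eqP; rewrite -[RHS]e; ring.
- by rewrite -[RHS]e; ring.
Qed.

(** With [a = 0] the relations are homogeneous. If [b] is nonzero, the first three make [d], [f],
    [h] multiples of [b], contradicting the fourth; then the same happens with [d] in place of [b].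
    The remaining t_k fall to [jacobi3_vanish_large]. *)
Lemma jacobi3_vanish c : pascal c -> jacobi3 c -> c 0 1 = 0 ->
  forall m n, c m n = 0.
Proof.
move=> cp cJ a0; have := jacobi3_relations cp cJ; rewrite a0.
move bE: (c 1 2) => b; move dE: (c 2 3) => d.
move: (c 3 4) (c 4 5) => f h [e1 e2 e3 e4].
have b0 : b = 0.
  apply/eqP/negPn/negP => bn0.
  have dE' : d = 4 / 3 * b.
    apply: (mulIf bn0); apply: (mulfI (natr_neq0 (isT : 3 != 0)%N)).
    by rewrite add0r in e1; rewrite mulrA e1; field; rewrite natr_neq0.
  have fE : f = 50 / 33 * b.
    apply: (mulIf bn0); apply: (mulfI (natr_neq0 (isT : 66 != 0)%N)).
    transitivity (- 9 * (f * (3 * 0 - 2 * b - 4 * d))).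
      by rewrite dE'; field; rewrite natr_neq0.
    by rewrite e2 dE'; field; rewrite !natr_neq0.
  have hE : h = 92 / 33 * b.
    apply: (mulIf bn0); apply: (mulfI (natr_neq0 (isT : 10 != 0)%N)).
    transitivity (3 * (h * (2 * b + d))).
      by rewrite dE'; field; rewrite natr_neq0.
    by rewrite e3 dE' fE; field; rewrite !natr_neq0.
  have : 70 * 84 * b ^+ 2 = 0.
    have <- : - 1089 * 0 = 0 :> F by rewrite mulr0.
    by rewrite -[in RHS]e4 dE' fE hE; field; rewrite !natr_neq0.
  by apply/eqP; rewrite !mulf_neq0 ?expf_neq0 ?natr_neq0.
have d0 : d = 0.
  move: e2 e3 e4; rewrite b0 => e2 e3 e4; apply/eqP/negPn/negP => dn0.
  have fE : f = 5 / 2 * d.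
    apply: (mulIf dn0); apply: (mulfI (natr_neq0 (isT : 4 != 0)%N)).
    transitivity (- (f * (3 * 0 - 2 * 0 - 4 * d))); first by ring.
    by rewrite e2; field; rewrite !natr_neq0.
  have hE : h = 10 * d.
    apply: (mulIf dn0); transitivity (h * (2 * 0 + d)); first by ring.
    by rewrite e3 fE; field; rewrite !natr_neq0.
  have : 105 * d ^+ 2 = 0.
    have <- : 2 * 0 = 0 :> F by rewrite mulr0.
    by rewrite -[in RHS]e4 fE hE; field; rewrite !natr_neq0.
  by apply/eqP; rewrite !mulf_neq0 ?expf_neq0 ?natr_neq0.
have t0 k : c k k.+1 = 0.
  elim/ltn_ind: k => -[|[|[|k]]] IHk; rewrite ?a0 ?bE ?dE //.
  exact: jacobi3_vanish_large.
by move=> m n; apply: (pascal_vanish (k := m + n) cp) => //; rewrite -addnn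
  leq_addr.
Qed.

(** The first three relations express [d], [f], [h] as rational functions of [b], once their
    denominators are known to be nonzero. The fourth becomes a polynomial equation in [b] with root
    1/7. *)
Lemma jacobi3_ratio c : pascal c -> jacobi3 c -> c 0 1 = 1 -> c 1 2 != 0 ->
  [/\ 7 * c 1 2 = 1, 42 * c 2 3 = 1 & 231 * c 3 4 = 1].
Proof.
move=> cp cJ a1 bn0; have := jacobi3_relations cp cJ; rewrite a1.
have := cJ 1 3 5; have := cJ 0 1 7.
rewrite !(pascal_valE _ _ cp) /pascal_val /= a1.
move: (c 1 2) (c 2 3) (c 3 4) (c 4 5) (c 5 6) bn0.
move=> b d f h g bn0 e5 e6 [e1 e2 e3 e4].
have n2 := natr_neq0 (isT : 2 != 0)%N; have n3 := natr_neq0 (isT : 3 != 0)%N.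
have n5 := natr_neq0 (isT : 5 != 0)%N.
have b1 : 1 + b != 0.
  apply: contraNneq bn0 => b1; move/eqP: e1; rewrite b1 mulr0 eq_sym mulf_eq0.
  by rewrite expf_eq0 /= (negPf (natr_neq0 _)).
have dE : d = 4 * b ^+ 2 / (3 * (1 + b)).
  apply: (mulIf b1); apply: (mulfI n3); rewrite mulrA e1.
  by field; rewrite n3 b1.
(* This is 3 (1 + b) times the coefficient 3 - 2b - 4d of [f] in the second relation. *)
pose D2 := 9 + 3 * b - 22 * b ^+ 2.
have e2' : 3 * f * (1 + b) * D2 = 20 * b ^+ 3 * (3 - 5 * b).
  transitivity (9 * (1 + b) ^+ 2 * (f * (3 * 1 - 2 * b - 4 * d))).
    by rewrite dE /D2; field; rewrite n3 b1.
  by rewrite e2 dE; field; rewrite n3 b1.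
have D20 : D2 != 0.
  apply/eqP => z; have b35 : 3 - 5 * b = 0.
    apply: (mulfI (mulf_neq0 (natr_neq0 (isT : 20 != 0)%N) (expf_neq0 3 bn0))).
    by rewrite mulr0 -e2' z mulr0.
  (* A Bezout identity: [D2] and 3 - 5b have no common root. *)
  have : 3 * 24 = 25 * D2 + (3 - 5 * b) * - (51 + 110 * b) by rewrite /D2; ring.
  by apply/eqP; rewrite z b35 !(mulr0, mul0r) addr0 !mulf_neq0 ?natr_neq0.
have fE : f = 20 * b ^+ 3 * (3 - 5 * b) / (3 * (1 + b) * D2).
  apply: (mulIf D20); apply: (mulIf b1); apply: (mulfI n3).
  transitivity (3 * f * (1 + b) * D2); first by ring.
  by rewrite e2'; field; rewrite D20 b1 n3.
have e3' : h * (3 + 5 * b) * b * 2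
    = 3 * (1 + b) * (4 * b * f + 6 * d * f - 5 * d ^+ 2).
  by rewrite -e3 dE; field; rewrite n3 b1.
(* The coefficient 2b + d of [h] is 2b (3 + 5b) / (3 (1 + b)). If it vanished, the other side of the
   third relation would be a nonzero constant. *)
have b350 : 3 + 5 * b != 0.
  apply/eqP => z; have bE : b = - (3 / 5).
    by apply: (mulfI n5); rewrite -[LHS](addKr 3) z addr0; field; rewrite n5.
  have : - (8 * 27 * 19 / 25) = h * (3 + 5 * b) * b * 2
      - 3 * (1 + b) * (4 * b * f + 6 * d * f - 5 * d ^+ 2).
    by rewrite dE fE /D2 bE; field; rewrite !(oppr_eq0, natr_neq0).
  rewrite e3' subrr; apply/eqP.
  by rewrite oppr_eq0 !mulf_neq0 ?invr_eq0 ?natr_neq0.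
have hE : h = 3 * (1 + b) * (4 * b * f + 6 * d * f - 5 * d ^+ 2)
    / (2 * b * (3 + 5 * b)).
  by rewrite -e3'; field; rewrite bn0 b350 n2.
(* The fourth relation after elimination of [d], [f] and [h], freed of denominators and of the
   factor 160 b^5. *)
have key : (7 * b - 1) * ((3 - 5 * b) * (7 * b ^+ 2 + 12 * b - 9)) = 0.
  apply: (mulfI (mulf_neq0 (natr_neq0 (isT : 160 != 0)%N) (expf_neq0 5 bn0))).
  rewrite mulr0; transitivity (3 * (1 + b) ^+ 2 * (3 + 5 * b) * D2 ^+ 2 * 0);
    last by rewrite mulr0.
  rewrite -[in RHS]e4.
  by rewrite hE fE dE /D2; field; rewrite -/D2 D20 b350 bn0 b1 n3 n2.
have [b7|/eqP b7] := eqVneq (7 * b) 1.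
  have bE : b = 1 / 7.
    apply: (mulfI (natr_neq0 (isT : 7 != 0)%N)); rewrite b7.
    by field; rewrite natr_neq0.
  split; first exact: b7.
    by rewrite dE bE; field; rewrite !natr_neq0.
  have dE' : d = 1 / 42 by rewrite dE bE; field; rewrite !natr_neq0.
  apply: (mulfI (natr_neq0 (isT : 5 != 0)%N)).
  transitivity (21 * 21 * (f * (3 * 1 - 2 * b - 4 * d))).
    by rewrite bE dE'; field; rewrite !natr_neq0.
  by rewrite e2 bE dE'; field; rewrite !natr_neq0.
(* The spurious roots 3/5 and (- 6 +- 3 sqrt 11) / 7 are excluded by the Jacobi
   identities for (0, 1, 7), which determines [g], and (1, 3, 5). *)
exfalso; move/eqP: key; rewrite mulf_eq0 subr_eq0; case/orP => [/eqP //|].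
rewrite mulf_eq0 => /orP[] /eqP z.
  have bE : b = 3 / 5.
    by apply: (mulfI n5); rewrite -[LHS]addr0 -z; field; rewrite n5.
  have f0 : f = 0 by rewrite fE z mulr0 mul0r.
  have dE' : d = 3 / 10 by rewrite dE bE; field; rewrite !natr_neq0.
  have hE' : h = - (3 / 10).
    by rewrite hE f0 dE' bE; field; rewrite !natr_neq0.
  have gE : g = - (1 / 2).
    apply: (mulfI (natr_neq0 (isT : 9 != 0)%N)); apply/eqP.
    rewrite -subr_eq0; apply/eqP; rewrite -[RHS](mulr0 5) -[in RHS]e5.
    by rewrite hE' f0 dE' bE; field; rewrite !natr_neq0.
  have : - (3 / 10) = 0 :> F.
    by rewrite -[RHS]e6 gE hE' f0 dE' bE; field; rewrite !natr_neq0.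
  by apply/eqP; rewrite oppr_eq0 mulf_neq0 ?invr_eq0 ?natr_neq0.
(* A square root of 11, whichever of the two roots [b] is; both cases are thus computed at once
   modulo [s ^+ 2 = 11]. *)
pose s := (7 * b + 6) / 3.
have bE : b = (3 * s - 6) / 7 by rewrite /s; field; rewrite !natr_neq0.
have s2 : s ^+ 2 = 11.
  apply/eqP; rewrite -subr_eq0; apply/eqP.
  rewrite -[RHS](mulr0 (7 / 9)) -[in RHS]z.
  by rewrite /s; field; rewrite !natr_neq0.
clearbody s.
have dE' : d = (6 * s - 18) / 7.
  apply: (mulIf b1); apply: (mulfI n3); rewrite mulrA e1 bE.
  by field: s2; rewrite natr_neq0.
have fE' : f = (42 * s - 138) / 35.
  apply: (mulfI (natr_neq0 (isT : 75 != 0)%N)).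
  (* The coefficient of [f] is 15 (7 - 2s) / 7; multiplying by the conjugate 7 + 2s makes it
     rational. The factor 2s + 5 below does the same for [h]. *)
  transitivity (7 * (7 + 2 * s) * (f * (3 * 1 - 2 * b - 4 * d))).
    by rewrite bE dE'; field: s2; rewrite natr_neq0.
  by rewrite e2 bE dE'; field: s2; rewrite !natr_neq0.
have hE' : h = (96 * s - 324) / 35.
  apply: (mulfI (natr_neq0 (isT : 6 * 19 != 0)%N)).
  transitivity (7 * (2 * s + 5) * (h * (2 * b + d))).
    by rewrite bE dE'; field: s2; rewrite natr_neq0.
  by rewrite e3 fE' bE dE'; field: s2; rewrite !natr_neq0.
have gE : g = (108 * s - 360) / 7.
  apply: (mulfI (natr_neq0 (isT : 12 != 0)%N)); apply/eqP.
  rewrite -subr_eq0; apply/eqP; rewrite -[RHS](mulr0 (4 + s)) -[in RHS]e5.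
  by rewrite hE' fE' dE' bE; field: s2; rewrite !natr_neq0.
have : 144 * 190 / 7 = 0 :> F.
  rewrite -[RHS](mulr0 ((10 + 3 * s) ^+ 2 * (127 - 67 * s))) -[in RHS]e6.
  by rewrite gE hE' fE' dE' bE; field: s2; rewrite !natr_neq0.
by apply/eqP; rewrite !mulf_neq0 ?invr_eq0 ?natr_neq0.
Qed.

(** The shifted table [c'] obeys the same recursion, and as long as it vanishes c(0, n+1) is
    constant. For the next entries t = c'(0, 2k+3) and A = c'(0, 2k+4), the Jacobi identity for 0,
    1, 2k+2 gives 2A = (2k+1) t, whereas skew-symmetry gives 2A = (2k+4) t. Hence 3t = 0. *)
Lemma jacobi3_m3 c : pascal c -> jacobi3 c -> c 0 1 != 0 -> c 1 2 = 0 ->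
  (forall n, c 0 n.+1 = c 0 1) /\ forall m n, c m.+1 n.+1 = 0.
Proof.
move=> cp cJ a0 b0; pose c' m n := c m.+1 n.+1.
have cp' : pascal c' by split=> m n; [apply: cp.1 | apply: cp.2].
have cS n : c 0 n.+2 = c 0 n.+1 - c' 0 n.
  by rewrite (cp.2 0 n.+1) addrAC subrr add0r.
have t0 k : c' k k.+1 = 0.
  elim/ltn_ind: k => -[|k] IHk //.
  have c0 := pascal_vanish cp' IHk.
  have x0 n : (n <= k.*2.+3)%N -> c 0 n.+1 = c 0 1.
    by elim: n => // n IHn nk; rewrite cS c0 ?subr0 ?IHn //; lia.
  have cr m n : (m + n)%N = k.+1.*2 -> c' m n = 0 by move=> mn; apply: c0; lia.
  have y1 := pascal_second cp' cr (m := k.*2.+1) (n := 3) ltac:(lia).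
  have := cJ 0 1 k.*2.+2; rewrite -[c 1 k.*2.+2]/(c' 0 k.*2.+1).
  rewrite (c0 0); last by lia.
  rewrite mul0r add0r (cp.1 0%N) x0; last by lia.
  rewrite addn0 (_ : k.*2.+2 + 3 = k.*2.+4.+1)%N; last by lia.
  rewrite -[c 1 _]/(c' 0 k.+1.*2.+2) -[c k.*2.+2 _]/(c' k.*2.+1 3).
  case: y1 => ->; rewrite exprS -signr_odd odd_double expr0 mulr1.
  rewrite (pascal_alternating cp' cr (m := k.+1)); last by lia.
  move: (c' 0 k.+1.*2.+2) (c' 0 k.+1.*2.+1) => A t A2 e.
  have kE : k.+1.*2.+2%:R = k.*2.+1%:R + 3 :> F by rewrite -natrD addn3.
  have : 3 * c 0 1 * t = 0.
    transitivity (c 0 1 * (k.+1.*2.+2%:R * t - 2 * A) - 0).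
      by rewrite kE -[X in _ = _ - X]e; ring.
    by rewrite A2 subrr mulr0 subr0.
  move/eqP; rewrite mulf_eq0 mulf_eq0 (negPf a0) (negPf (natr_neq0 _)) //=.
  by move/eqP => ->; rewrite mulr0.
split=> [|m n]; last by apply: (pascal_vanish (k := m + n) cp') => // *; lia.
elim=> // n IHn; rewrite cS IHn.
by rewrite (pascal_vanish (k := n) cp') ?subr0 //; lia.
Qed.

(* A difference of two solutions that first appears in degree 2k+1 is
   [(-1) ^+ m * t]; in the Jacobi identity for 0, 1, 2k-3 it occurs linearly,
   with the coefficient assumed to be nonzero. *)
Lemma jacobi3_unique c c' : pascal c -> jacobi3 c -> pascal c' -> jacobi3 c' ->
  (forall k, (k < 4)%N -> c k k.+1 = c' k k.+1) ->
  (forall k, (3 < k)%N -> c' 1 (k.*2 - 3)%N + c' 0 (k.*2 - 3)%N != c' 0 1) ->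
  forall m n, c m n = c' m n.
Proof.
move=> cp cJ cp' cJ' c03 c'n0; pose D m n := c m n - c' m n.
have Dp : pascal D.
  split=> m n; rewrite /D; first by rewrite (cp.1 m) (cp'.1 m); ring.
  by rewrite (cp.2 m n) (cp'.2 m n); ring.
suff t0 k : D k k.+1 = 0.
  move=> m n; apply/eqP; rewrite -subr_eq0 -/(D m n).
  rewrite (pascal_vanish (k := m + n) Dp) //.
  by rewrite -addnn leq_addr.
elim/ltn_ind: k => k IHk; have [k4|k4] := ltnP k 4.
  by rewrite /D c03 ?subrr.
have D0 := pascal_vanish Dp IHk.
have cE m n : (m + n <= k.*2)%N -> c m n = c' m n.
  by move=> mn; apply/eqP; rewrite -subr_eq0 -/(D m n) D0.
have alt := pascal_alternating Dp (r := k.*2)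
  (fun m n mn => D0 m n (eq_leq mn)).
have DE m n : c m n = D m n + c' m n by rewrite subrK.
have jE : k.*2 = (k.*2 - 3 + 3)%N by lia.
move: c'n0 => /(_ k k4); move: (cJ 0 1 (k.*2 - 3)%N) (cJ' 0 1 (k.*2 - 3)%N).
rewrite (cE 1); last by lia.
rewrite (cE _ 0); last by lia.
rewrite (cE 0 1); last by lia.
have -> : (1 + (k.*2 - 3) + 3 = k.*2.+1)%N by lia.
have -> : (k.*2 - 3 + 0 + 3 = k.*2)%N by lia.
have -> : (0 + 1 + 3 = 4)%N by [].
rewrite !DE (alt 1%N) // (alt (k.*2 - 3)%N 4%N); last by lia.
rewrite -[(-1) ^+ (k.*2 - 3)]signr_odd oddB ?odd_double /=; last by lia.
rewrite (alt k k.+1); last by lia.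
rewrite (cp'.1 0%N).
move: (D 0 _) => t e e' cn0.
have : (c' 1 (k.*2 - 3)%N + c' 0 (k.*2 - 3)%N - c' 0 1) * t = 0.
  by rewrite -[RHS]subr0 -[X in _ = X - _]e -e'; ring.
move/eqP; rewrite mulf_eq0 subr_eq0 (negPf cn0) /= => /eqP ->.
by rewrite mulr0.
Qed.

(* The structure constants of W^3 for v_n proportional to (n + 1)! e_(n+3). *)
Definition witt_coef (a : F) m n : F :=
  a * (n%:R - m%:R) * m.+1`!%:R * n.+1`!%:R / (m + n).+4`!%:R.

Lemma natr_fact_neq0 n : n`!%:R != 0 :> F.
Proof. by rewrite natr_neq0 // -lt0n fact_gt0. Qed.

Lemma natr_factS n : n.+1`!%:R = (n%:R + 1) * n`!%:R :> F.
Proof. by rewrite factS natrM natr1. Qed.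

Lemma witt_pascal a : pascal (witt_coef a).
Proof.
split=> m n; rewrite /witt_coef; first by rewrite addnC; ring.
rewrite addSn addnS !(natr_factS m.+1) !(natr_factS n.+1).
rewrite !(natr_factS (m + n).+4).
have := natr_fact_neq0 (m + n).+4.
have := natr_neq0 (isT : (m + n).+4.+1 != 0)%N.
move: (_`!%:R) (_`!%:R) (_`!%:R) => u v w.
by rewrite -!natr1 natrD => n1 n2; field; rewrite ?n1 ?n2.
Qed.

(** In each product the factorial belonging to the inner bracket cancels; what remains is the Jacobi
    identity of W^3. *)
Lemma witt_jacobi3 a : jacobi3 (witt_coef a).
Proof.
move=> i j k; rewrite /witt_coef.
have -> : (k + i + 3 = (k + i).+3)%N by lia.
have -> : (j + k + 3 = (j + k).+3)%N by lia.
have -> : (i + j + 3 = (i + j).+3)%N by lia.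
have -> : (i + (j + k).+3 = (i + j + k).+3)%N by lia.
have -> : (j + (k + i).+3 = (i + j + k).+3)%N by lia.
have -> : (k + (i + j).+3 = (i + j + k).+3)%N by lia.
have := natr_fact_neq0 (i + j + k).+3.+4.
have := natr_fact_neq0 (k + i).+4.
have := natr_fact_neq0 (i + j).+4.
have := natr_fact_neq0 (j + k).+4.
move: (_`!%:R) (_`!%:R) (_`!%:R) (_`!%:R) (_`!%:R) (_`!%:R) (_`!%:R).
move=> u v w x y z t.
rewrite -!natr1 !natrD => n1 n2 n3 n4; field.
by rewrite n1 n2 n3 n4.
Qed.

(* The difference of the two sides is a nonzero multiple of
   (j - 1) (j - 3) (j + 8) (j + 10), where j = 2k - 3 >= 5. *)
Lemma witt_jacobi3_neq k : (3 < k)%N ->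
  witt_coef 60 1 (k.*2 - 3) + witt_coef 60 0 (k.*2 - 3) != witt_coef 60 0 1.
Proof.
move=> k3; set j := (k.*2 - 3)%N.
have [i ->] : exists i, j = i.+4 by exists (j - 4)%N; lia.
rewrite /witt_coef add0n add1n addn1 -subr_eq0.
rewrite !(natr_factS _.+4) !(natr_factS _.+3).
have := natr_fact_neq0 i.+3; move: (i.+3`!%:R) => w wn0.
rewrite [X in X != 0](_ : _ = - ((i + 3) * (i + 1) * (i + 12) * (i + 14))%:R
    / ((i + 6) * (i + 7) * (i + 8) * (i + 9))%:R).
  by rewrite mulf_neq0 ?invr_eq0 ?oppr_eq0 ?natr_neq0 // !muln_eq0; lia.
rewrite (_ : 2`! = 2)%N // (_ : 3`! = 6)%N // (_ : 1`! = 1)%N // !natrM.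
have iE n : i%:R + n.+1%:R != 0 :> F by rewrite -natrD natr_neq0 // addnS.
field; rewrite !iE wn0 natr_neq0 //=.
have -> : 3 + i%:R + 1 = i%:R + 4 :> F by ring.
have -> : 4 + i%:R + 1 = i%:R + 5 :> F by ring.
by rewrite !iE.
Qed.

Lemma pascal_scale a c : pascal c -> pascal (fun m n => a * c m n).
Proof. by case=> cS cR; split=> m n; rewrite ?(cS m) ?(cR m n); ring. Qed.

Lemma jacobi3_scale a c : jacobi3 c -> jacobi3 (fun m n => a * c m n).
Proof.
by move=> cJ i j k; rewrite -[RHS](mulr0 (a ^+ 2)) -(cJ i j k); ring.
Qed.

Lemma jacobi3_classification c : pascal c -> jacobi3 c ->
  [\/ forall m n, c m n = 0,
      c 0 1 != 0 /\ (forall n, c 0 n.+1 = c 0 1) /\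
        (forall m n, c m.+1 n.+1 = 0)
    | exists2 a, a != 0 & forall m n, c m n = witt_coef a m n].
Proof.
move=> cp cJ; have [a0|a0] := eqVneq (c 0 1) 0.
  by apply: Or31; apply: jacobi3_vanish.
have [b0|b0] := eqVneq (c 1 2) 0.
  by apply: Or32; split=> //; apply: jacobi3_m3.
(* The factor is 60 because [witt_coef a 0 1] equals a/60. *)
apply: Or33; exists (60 * c 0 1) => [|m n].
  by rewrite mulf_neq0 ?natr_neq0.
(* Both conditions are homogeneous, so c(0, 1) may be normalized to 1. *)
have dp := pascal_scale (c 0 1)^-1 cp; have dJ := jacobi3_scale (c 0 1)^-1 cJ.
have [||d1 d2 d3] := jacobi3_ratio dp dJ; first by rewrite mulVf.
  by rewrite mulf_neq0 ?invr_eq0.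
have E := jacobi3_unique dp dJ (witt_pascal 60) (witt_jacobi3 60) _
  witt_jacobi3_neq.
apply: (mulfI (invr_neq0 a0)); rewrite E.
  by rewrite /witt_coef; field; rewrite ?a0 ?natr_fact_neq0.
have WE r k : (0 < r)%N ->
    r%:R * 60 * k.+1`!%:R * k.+2`!%:R = (k + k.+1).+4`!%:R :> F ->
    forall t, r%:R * t = 1 -> t = witt_coef 60 k k.+1.
  move=> r0 rE t tE; apply: (mulfI (natr_neq0 (lt0n_neq0 r0))).
  rewrite tE /witt_coef -[k.+1%:R]natr1 addrAC subrr add0r mulr1 !mulrA rE.
  by rewrite divff ?natr_fact_neq0.
case=> [|[|[|[|//]]]] _; [apply: (WE 1%N) | apply: (WE 7%N) | apply: (WE 42%N)
  | apply: (WE 231%N)] => //; try by rewrite !natr_factS fact0; ring.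
by rewrite mul1r mulVf.
Qed.
End StructureConstants.

(** * Lie algebras given by a table *)

Section LieBasics.
Variables (F : fieldType) (L : lieAlgType F).
Implicit Types (x y z : L) (a : F).

HB.instance Definition _ x :=
  GRing.isLinear.Build F L L *:%R (lie x) (lie_linearr x).

Lemma lieDr x y z : lie x (y + z) = lie x y + lie x z.
Proof. exact: linearD. Qed.

Lemma lieZr x a y : lie x (a *: y) = a *: lie x y.
Proof. exact: linearZ. Qed.

Lemma lieC x y : lie x y = - lie y x.
Proof.
apply/eqP; rewrite -addr_eq0; have := liexx (x + y).
rewrite lieDr -[lie (x + y) x]scale1r -[lie (x + y) y]scale1r.
have := lie_linearl x 1 x y; have := lie_linearl y 1 x y.
rewrite !scale1r => -> ->; rewrite !liexx add0r addr0 addrC => ->.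
exact: eqxx.
Qed.

Lemma lieDl x y z : lie (x + y) z = lie x z + lie y z.
Proof. by rewrite lieC lieDr opprD -!lieC. Qed.

Lemma lieZl a x y : lie (a *: x) y = a *: lie x y.
Proof. by rewrite lieC lieZr -scalerN -lieC. Qed.

Lemma lie0l x : lie 0 x = 0.
Proof. by rewrite lieC linear0 oppr0. Qed.

Lemma lie_suml I (r : seq I) (P : pred I) (f : I -> L) y :
  lie (\sum_(i <- r | P i) f i) y = \sum_(i <- r | P i) lie (f i) y.
Proof.
by rewrite lieC linear_sum -sumrN; apply: eq_bigr => i _; rewrite -lieC.
Qed.

Lemma lie_derivation x y z :
  lie x (lie y z) = lie (lie x y) z + lie y (lie x z).
Proof.
have /eqP := lie_jacobi x y z.
rewrite (lieC z x) linearN /= (lieC z) -addrA -opprD subr_eq0 => /eqP ->.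
exact: addrC.
Qed.

End LieBasics.

Definition lincomb (F : fieldType) (L : lmodType F) (u : nat -> L)
    (p : {poly F}) : L :=
  \sum_(k < size p) p`_k *: u k.

Section LinearCombination.
Variables (F : fieldType) (L : lmodType F) (u : nat -> L).

Lemma lincombE n (p : {poly F}) : (size p <= n)%N ->
  lincomb u p = \sum_(k < n) p`_k *: u k.
Proof.
move=> pn; rewrite /lincomb (big_ord_widen n (fun k => p`_k *: u k)) //.
rewrite big_mkcond; apply: eq_bigr => k _; case: ltnP => // pk.
by rewrite nth_default ?scale0r.
Qed.

Lemma lincomb_is_linear : linear (lincomb u).
Proof.
move=> a p q; pose n := maxn (size p) (size q).
have pn : (size p <= n)%N by rewrite leq_maxl.
have qn : (size q <= n)%N by rewrite leq_maxr.
rewrite !(@lincombE n) //; last first.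
  apply: leq_trans (size_polyD _ _) _; rewrite geq_max qn andbT.
  exact: leq_trans (size_scale_leq _ _) pn.
rewrite scaler_sumr -big_split; apply: eq_bigr => k _ /=.
by rewrite coefD coefZ scalerDl scalerA.
Qed.

HB.instance Definition _ :=
  GRing.isLinear.Build F {poly F} L *:%R (lincomb u) lincomb_is_linear.

Lemma lincombXn k : lincomb u 'X^k = u k.
Proof.
rewrite (@lincombE k.+1) ?size_polyXn // big_ord_recr /= coefXn eqxx scale1r.
by rewrite big1 ?add0r // => i _; rewrite coefXn ltn_eqF // scale0r.
Qed.

End LinearCombination.

(** The map that is easy to write goes from the table algebra to [L], sending ['X^k] to [u k]. The
    isomorphism wanted is its inverse, whose properties follow by injectivity. *)
Lemma lie_iso_table (F : fieldType) (L : lieAlgType F) (c : lie_table)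
    (u : nat -> L) :
    (forall x, exists p, x = lincomb u p) ->
    (forall p, lincomb u p = 0 -> p = 0) ->
    (forall k l, lie (u k) (u l) = (c (degree_of k) (degree_of l))%:~R
      *: u (degree_of k + degree_of l - 2)%N) ->
  lie_iso L (table_algebra F c).
Proof.
move=> uspan ufree ulie; pose V := table_algebra F c.
pose hL := GRing.isLinear.Build F V L *:%R (lincomb u) (lincomb_is_linear u).
pose hh : {linear V -> L} := HB.pack (lincomb u : V -> L) hL.
have hX k : hh 'X^k = u k by exact: lincombXn.
have h_lie (p q : V) : hh (lie p q) = lie (hh p) (hh q).
  have hhE (r : V) :
      hh r = \sum_(k < size (r : {poly F})) (r : {poly F})`_k *: u k by [].
  rewrite [lie p q]/(table_bracket p q) /table_bracket linear_sum.
  rewrite (hhE p) lie_suml; apply: eq_bigr => k _.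
  rewrite linear_sum (hhE q) lieZl linear_sum scaler_sumr.
  apply: eq_bigr => l _; rewrite [in RHS]/= lieZr ulie linearZ.
  by rewrite /basis_vector hX !scalerA.
have h_bij : bijective hh.
  have inv x : {p : V | x = hh p} by apply: cid; exact: uspan.
  exists (fun x => sval (inv x)) => [p|x]; last by case: inv.
  case: inv => q /= pq; have : hh (q - p) = 0 by rewrite linearB /= pq subrr.
  by move/ufree/eqP; rewrite subr_eq0 => /eqP.
case: (h_bij) => h' hK h'K.
have h'_lin : linear h'.
  move=> a x y; apply: (can_inj hK); rewrite h'K.
  by transitivity (a *: hh (h' x) + hh (h' y)); [rewrite !h'K|rewrite linearP].
pose hL' := GRing.isLinear.Build F L V *:%R h' h'_lin.
pose hh' : {linear L -> V} := HB.pack h' hL'.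
exists hh'; split; first by exists hh.
move=> x y; apply: (can_inj hK); rewrite -[RHS]/(hh (lie (h' x) (h' y))) h_lie.
by rewrite !h'K.
Qed.

(** * The lower central series *)

Section Subspaces.
Variables (F : fieldType) (L : lieAlgType F).
Implicit Types (A U V : set L) (x y z : L).

Lemma subspaceP A :
  subspace A <-> A 0 /\ forall a x y, A x -> A y -> A (a *: x + y).
Proof.
split=> -[A0 AP]; split; rewrite ?inE // in A0 *.
  by move=> a x y Ax Ay; have := AP a x y; rewrite !inE; apply.
by move=> a x y; rewrite !inE; apply: AP.
Qed.

Section Closed.
Variables (A : set L) (sA : subspace A).

Lemma subspace0 : A 0.
Proof. by case/subspaceP: sA. Qed.

Lemma subspaceD x y : A x -> A y -> A (x + y).
Proof. by case/subspaceP: sA => _ /(_ 1 x y); rewrite scale1r. Qed.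

Lemma subspaceZ a x : A x -> A (a *: x).
Proof.
by move=> Ax; case/subspaceP: sA => A0 /(_ a x 0 Ax A0); rewrite addr0.
Qed.

Lemma subspaceN x : A x -> A (- x).
Proof. by rewrite -scaleN1r; apply: subspaceZ. Qed.

Lemma subspaceB x y : A x -> A y -> A (x - y).
Proof. by move=> Ax /subspaceN; apply: subspaceD. Qed.

Lemma subspace_sum I (r : seq I) (P : pred I) (f : I -> L) :
  (forall i, P i -> A (f i)) -> A (\sum_(i <- r | P i) f i).
Proof.
by move=> Af; apply: big_ind => //; [exact: subspace0|exact: subspaceD].
Qed.

End Closed.

Lemma subspace_smallest A : subspace (smallest (@subspace F L) A).
Proof.
apply/subspaceP; split=> [|a x y Ax Ay] B [sB AB]; first exact: subspace0.
by apply: subspaceD (subspaceZ _ _ _) _ => //; [apply: Ax | apply: Ay].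
Qed.

(* Coordinates on U / V, extended by 0 to a map on the whole algebra. *)
Lemma quotient_coordinates U V d :
  subspace U -> subspace V -> quotient_dim U V d ->
  exists phi : L -> 'rV[F]_d,
    (forall a x y, U x -> U y -> phi (a *: x + y) = a *: phi x + phi y) /\
    (forall x, U x -> (phi x = 0 <-> V x)).
Proof.
move=> sU sV [VU [v [Uv vb]]].
pose comb (c : 'rV[F]_d) := \sum_k c 0 k *: v k.
have combP a c c' : comb (a *: c + c') = a *: comb c + comb c'.
  rewrite /comb scaler_sumr -big_split; apply: eq_bigr => k _ /=.
  by rewrite !mxE scalerDl scalerA.
have [phi phiE] : {phi & forall x, U x -> V (x - comb (phi x))}.
  apply: (@boolp.choice _ _ (fun x c => U x -> V (x - comb c))) => x.
  have [/vb[c [Vc _]]|nU] := pselect (U x).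
    by exists c.
  by exists 0.
have uniq x c c' : U x -> V (x - comb c) -> V (x - comb c') -> c = c'.
  by move=> /vb[c0 [_ c0P]] /c0P <- /c0P <-.
have UP a x y : U x -> U y -> U (a *: x + y).
  by move=> Ux Uy; apply: subspaceD => //; apply: subspaceZ.
exists phi; split=> [a x y Ux Uy|x Ux].
  apply: (uniq (a *: x + y)) => //; [exact: UP | exact/phiE/UP |].
  rewrite combP opprD addrACA -scalerBr.
  apply: subspaceD => //; last exact: phiE.
  by apply: subspaceZ => //; apply: phiE.
have comb0 : comb 0 = 0 by apply: big1 => k _; rewrite mxE scale0r.
split=> [p0|Vx]; first by have := phiE x Ux; rewrite p0 comb0 subr0.
by apply: (uniq x) => //; [apply: phiE | rewrite comb0 subr0].
Qed.

Lemma quotient_dim1 U V v z : subspace U -> subspace V -> quotient_dim U V 1 ->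
  U v -> ~ V v -> U z -> exists a, V (z - a *: v).
Proof.
move=> sU sV /quotient_coordinates -/(_ sU sV)[phi [phiP phi0]] Uv nVv Uz.
have pv0 : phi v 0 0 != 0.
  apply/eqP => p0; apply/nVv/phi0 => //; apply/rowP => i.
  by rewrite ord1 p0 mxE.
exists (phi z 0 0 / phi v 0 0); rewrite addrC -scaleNr.
apply/phi0; first by apply: subspaceD => //; apply: subspaceZ.
by apply/rowP => i; rewrite ord1 phiP // !mxE mulNr divfK // addNr.
Qed.

(** Cramer's rule in coordinates on U / V: a zero determinant would make [s] and [t] proportional
    modulo [V]. *)
Lemma quotient_dim2 U V s t z : subspace U -> subspace V ->
  quotient_dim U V 2 -> U s -> U t -> ~ V s -> (forall a, ~ V (t - a *: s)) ->
  U z -> exists a b, V (z - a *: s - b *: t).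
Proof.
move=> sU sV /quotient_coordinates -/(_ sU sV)[phi [phiP phi0]].
move=> Us Ut nVs nVst Uz.
have row2 (p : 'rV[F]_2) : p 0 0 = 0 -> p 0 1 = 0 -> p = 0.
  move=> p0 p1; apply/rowP => i; rewrite mxE.
  have [->|->] // : i = 0 \/ i = 1.
  by case: i => [[|[|//]] ?]; [left|right]; apply: val_inj.
have Us' a x y : U x -> U y -> U (- a *: x + y).
  by move=> Ux Uy; apply: subspaceD => //; apply: subspaceZ.
have det0 : phi s 0 0 * phi t 0 1 - phi s 0 1 * phi t 0 0 != 0.
  apply/negP => /eqP det0.
  suff [a [a0 a1]] : exists a,
      phi t 0 0 = a * phi s 0 0 /\ phi t 0 1 = a * phi s 0 1.
    apply: (nVst a); rewrite addrC -scaleNr; apply/phi0; first exact: Us'.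
    by rewrite phiP //; apply: row2; rewrite !mxE ?a0 ?a1 mulNr addNr.
  have [s0|s0] := eqVneq (phi s 0 0) 0; last first.
    exists (phi t 0 0 / phi s 0 0); split; first by rewrite divfK.
    apply: (mulfI s0); apply/eqP; rewrite -subr_eq0; apply/eqP.
    by rewrite -[RHS]det0; field.
  have s1 : phi s 0 1 != 0.
    by apply/eqP => s1; apply/nVs/phi0 => //; apply: row2.
  exists (phi t 0 1 / phi s 0 1); split; last by rewrite divfK.
  apply: (mulfI s1); rewrite s0 !mulr0; move: det0; rewrite s0 mul0r sub0r.
  by move/eqP; rewrite oppr_eq0 => /eqP.
exists ((phi z 0 0 * phi t 0 1 - phi z 0 1 * phi t 0 0)
  / (phi s 0 0 * phi t 0 1 - phi s 0 1 * phi t 0 0)).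
exists ((phi s 0 0 * phi z 0 1 - phi s 0 1 * phi z 0 0)
  / (phi s 0 0 * phi t 0 1 - phi s 0 1 * phi t 0 0)).
rewrite addrC -scaleNr (addrC z) -scaleNr.
apply/phi0; first by do 2 apply: (Us' _ _) => //.
by rewrite !phiP //; [apply: row2; rewrite !mxE; field | exact: Us'].
Qed.

Lemma quotient_dim0 U V : quotient_dim U V 0 -> U = V.
Proof.
case=> VU [v [_ vP]]; apply/seteqP; split=> // x /vP[c [Vc _]].
by rewrite big_ord0 subr0 in Vc.
Qed.

Lemma quotient_dim_refl U d : subspace U -> quotient_dim U U d -> d = 0%N.
Proof.
move=> sU [_ [v [Uv /(_ 0 (subspace0 sU))[c [_ cP]]]]].
case: d => // d in v Uv c cP *; have Uc (c' : 'rV_d.+1) : c = c'.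
  apply: cP; apply: subspaceB => //; first exact: subspace0.
  by apply: subspace_sum => // k _; apply: subspaceZ.
have := Uc (const_mx 1); rewrite (Uc 0) => /rowP/(_ 0); rewrite !mxE.
by move/eqP; rewrite eq_sym oner_eq0.
Qed.

Notation G := (@lcs F L).

Lemma subspace_lcs n : subspace (G n).
Proof.
case: n => [|n]; last exact: subspace_smallest.
by apply/subspaceP; split.
Qed.

Lemma lcs0 n : G n 0. Proof. exact: subspace0 (subspace_lcs n). Qed.

Lemma lcsD n x y : G n x -> G n y -> G n (x + y).
Proof. exact: (subspaceD (subspace_lcs n)). Qed.

Lemma lcsZ n a x : G n x -> G n (a *: x).
Proof. exact: (subspaceZ (subspace_lcs n)). Qed.

Lemma lcsN n x : G n x -> G n (- x).
Proof. exact: (subspaceN (subspace_lcs n)). Qed.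

Lemma lcsB n x y : G n x -> G n y -> G n (x - y).
Proof. exact: (subspaceB (subspace_lcs n)). Qed.

Lemma lcs_lie n x y : G n y -> G n.+1 (lie x y).
Proof. by move=> Gy A [_ +]; apply; exists x => //; exists y. Qed.

Lemma lcs_lier n x y : G n x -> G n.+1 (lie x y).
Proof.
by move=> Gx; rewrite lieC; apply: (@lcsN n.+1); apply: lcs_lie.
Qed.

Lemma lcs_sub n A : subspace A -> (forall x y, G n y -> A (lie x y)) ->
  G n.+1 `<=` A.
Proof.
by move=> sA GA; apply: smallest_sub => // _ [x _ [y Gy <-]]; apply: GA.
Qed.

Lemma lcsS n : G n.+1 =
  smallest (@subspace F L) [set lie x y | x in setT & y in G n].
Proof. by []. Qed.

Local Opaque lcs.

Lemma lcs_decrS n : G n.+1 `<=` G n.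
Proof.
elim: n => // n IHn; apply: lcs_sub => [|x y Gy]; first exact: subspace_lcs.
by apply: lcs_lie; apply: IHn.
Qed.

Lemma lcs_decr m n : (m <= n)%N -> G n `<=` G m.
Proof.
move/subnK <-; elim: (n - m)%N => // k IHk x /lcs_decrS; exact: IHk.
Qed.

(** In the usual numbering, [g^(i+1), g^(j+1)] lies in g^(i+j+2). The Jacobi identity rewrites
    [[a, b], c] by brackets whose inner ones are covered by induction on [i]. *)
Lemma lcs_lie_add i j x y : G i x -> G j y -> G (i + j).+1 (lie x y).
Proof.
elim: i j x y => [|i IHi] j x y Gx Gy; first exact: lcs_lie.
pose A := [set a | forall j b, G j b -> G (i.+1 + j).+1 (lie a b)].
suff /(_ x Gx) : G i.+1 `<=` A by apply.
apply: lcs_sub => [|a b Gb k c Gc].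
  apply/subspaceP; split=> [k b _|a u v Au Av k b Gb].
    by rewrite lie0l; apply: lcs0.
  by rewrite lieDl lieZl; apply: lcsD; [apply: lcsZ; apply: Au | apply: Av].
have -> : lie (lie a b) c = lie a (lie b c) - lie b (lie a c).
  by rewrite lie_derivation addrK.
apply: lcsB.
  by rewrite addSn; apply: lcs_lie; exact: IHi Gb Gc.
by rewrite addSnnS; apply: IHi Gb _; apply: lcs_lie.
Qed.

Lemma lcs_stationary n m : G n = G n.+1 -> (n <= m)%N -> G m = G n.
Proof.
move=> Gn /subnK <-; elim: (m - n)%N => // k IHk.
by rewrite addSn lcsS IHk -lcsS.
Qed.

(** Modulo [G 2], every bracket reduces to a multiple of [v, v]. *)
Lemma lcs_cyclic v : (forall x, exists a, G 1 (x - a *: v)) -> G 1 = G 2.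
Proof.
move=> vP; apply/seteqP; split; last exact: lcs_decrS.
apply: lcs_sub => [|x y _]; first exact: subspace_lcs.
have [a Ga] := vP x; have [b Gb] := vP y.
rewrite -(subrK (b *: v) y) lieDr; apply: lcsD; first exact: lcs_lie.
rewrite -(subrK (a *: v) x) lieDl lieZr; apply: lcsD.
  by apply: lcsZ; apply: lcs_lier.
by rewrite lieZl lieZr liexx !scaler0; apply: lcs0.
Qed.

(** No [d n] is 0, for the series would be stationary from there on, and [d 0] is not 1 by
    [lcs_cyclic]. So all terms of the sum are nonnegative and the first is positive; as the total is
    1, the others vanish. *)
Lemma maximal_class_dims : maximal_class L ->
  quotient_dim (G 0) (G 1) 2 /\ forall n, quotient_dim (G n.+1) (G n.+2) 1.
Proof.
move=> [_ [d [dP [N dN]]]].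
have d_gt0 n : (0 < d n)%N.
  rewrite lt0n; apply/eqP => dn0.
  have := dP n; rewrite dn0 => /quotient_dim0 Gn.
  have dm m : (n <= m)%N -> d m = 0%N.
    move=> nm; have := dP m; rewrite (lcs_stationary Gn (leqW nm)).
    rewrite (lcs_stationary Gn nm); apply: quotient_dim_refl.
    exact: subspace_lcs.
  (* Past [n] each further term of the sum would be -1, so the partial sums could not settle. *)
  have := dN _ (leq_maxl N n); have := dN _ (leqW (leq_maxl N n)).
  by rewrite big_ord_recr /= => e1 e2; move: e1; rewrite e2 dm ?leq_maxr.
have d0 : d 0%N != 1%N.
  apply/eqP => d01; have G12 : G 1 = G 2.
    have := dP 0%N; rewrite d01 => -[_ [v [_ vP]]].
    apply: (@lcs_cyclic (v 0)) => x; have [|c [+ _]] := vP x; first by [].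
    by rewrite big_ord1; exists (c 0 0).
  have := dP 1%N; rewrite -G12 => /(quotient_dim_refl (subspace_lcs 1))/eqP.
  by rewrite eqn0Ngt d_gt0.
suff dE : forall n, d n = (n == 0%N).+1.
  by split=> [|n]; [have := dP 0%N | have := dP n.+1]; rewrite dE.
have e_sum n : (N <= n)%N -> (\sum_(i < n.+1) (d i).-1 = 1)%N.
  move=> Nn; apply/eqP; rewrite -eqz_nat (big_morph Posz PoszD erefl).
  apply/eqP; apply: etrans (dN n.+1 (leqW Nn)); apply: eq_bigr => i _.
  by have := d_gt0 i; lia.
have d00 := d_gt0 0%N; move=> n; have := e_sum _ (leq_maxl N n).
rewrite big_ord_recl /=; case: n => [|n]; first by lia.
have nM : (n < maxn N n.+1)%N by rewrite leq_max leqnn orbT.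
rewrite (bigD1 (Ordinal nM)) //= /bump leq0n add1n.
by have := d_gt0 n.+1; lia.
Qed.

End Subspaces.

Local Opaque lcs.

(** * Congruence modulo a term of the lower central series *)

Section Congruence.
Variables (F : fieldType) (L : lieAlgType F).
Notation G := (@lcs F L).
Implicit Types (x y z : L).

Definition lcs_eq n x y := G n (x - y).

Lemma lcs_eqxx n x : lcs_eq n x x.
Proof. by rewrite /lcs_eq subrr; apply: lcs0. Qed.

Lemma lcs_eq0 n x : lcs_eq n x 0 <-> G n x.
Proof. by rewrite /lcs_eq subr0. Qed.

Lemma lcs_eqC n x y : lcs_eq n x y -> lcs_eq n y x.
Proof. by move/lcsN; rewrite opprB. Qed.

Lemma lcs_eq_trans n y x z : lcs_eq n x y -> lcs_eq n y z -> lcs_eq n x z.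
Proof. by move=> xy /(lcsD xy); rewrite addrA subrK. Qed.

Lemma lcs_eqD n x x' y y' :
  lcs_eq n x x' -> lcs_eq n y y' -> lcs_eq n (x + y) (x' + y').
Proof. by move=> xx' /(lcsD xx'); rewrite addrACA -opprD. Qed.

Lemma lcs_eqN n x x' : lcs_eq n x x' -> lcs_eq n (- x) (- x').
Proof. by move/lcsN; rewrite opprD. Qed.

Lemma lcs_eqB n x x' y y' :
  lcs_eq n x x' -> lcs_eq n y y' -> lcs_eq n (x - y) (x' - y').
Proof. by move=> xx' /lcs_eqN; apply: lcs_eqD. Qed.

Lemma lcs_eqZ n a x x' : lcs_eq n x x' -> lcs_eq n (a *: x) (a *: x').
Proof. by move/(lcsZ a); rewrite scalerBr. Qed.

Lemma lcs_eq_lie n x y y' : lcs_eq n y y' -> lcs_eq n.+1 (lie x y) (lie x y').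
Proof. by move/(lcs_lie x); rewrite linearB. Qed.

Lemma lcs_eq_liel i j x x' y :
  lcs_eq i x x' -> G j y -> lcs_eq (i + j).+1 (lie x y) (lie x' y).
Proof.
move=> + Gy => /(lcs_lie_add)/(_ Gy).
by rewrite lieDl -scaleN1r lieZl scaleN1r.
Qed.

Lemma lcs_eq_mem n x y : lcs_eq n x y -> G n y -> G n x.
Proof. by move=> + Gy => /lcsD/(_ Gy); rewrite subrK. Qed.

End Congruence.

(** * Two-step centralizers *)

Section MaximalClass.
Variables (F : fieldType) (L : lieAlgType F).
Hypothesis F0 : [pchar F] =i pred0.
Notation G := (@lcs F L).
Hypothesis dimG : forall n, quotient_dim (G n.+1) (G n.+2) 1.
Implicit Types (x y z : L).

Lemma lcs_proper n : ~ (G n.+1 `<=` G n.+2).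
Proof.
move=> Gn; have := dimG n; have -> : G n.+2 = G n.+1.
  by apply/seteqP; split=> //; apply: lcs_decrS.
by move/(quotient_dim_refl (@subspace_lcs F L n.+1)).
Qed.

Lemma lcs_line n v z : G n.+1 v -> ~ G n.+2 v -> G n.+1 z ->
  exists a, lcs_eq n.+2 z (a *: v).
Proof.
exact: (quotient_dim1 (@subspace_lcs F L n.+1) (@subspace_lcs F L n.+2)
  (dimG n)).
Qed.

Definition generating x y := forall z, exists a b, lcs_eq 1 z (a *: x + b *: y).

Definition iter_ad x y n : L := iter n (lie x) y.

Lemma iter_ad_lcs x y n : G n (iter_ad x y n).
Proof. by elim: n => // n IHn; apply: lcs_lie. Qed.

Lemma generating_lie x y n g h : generating x y -> G n h ->
  exists a b, lcs_eq n.+2 (lie g h) (a *: lie x h + b *: lie y h).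
Proof.
move=> /(_ g)[a [b gE]] Gh; exists a, b.
by have := lcs_eq_liel gE Gh; rewrite lieDl !lieZl add1n.
Qed.

(** Modulo the next term but one, bracketing with [g] is a combination of ad x and ad y, and the ad
    y part drops out by hypothesis. Induction on [i] leaves only iterates of ad x. *)
Lemma iter_ad_gen x y N : generating x y ->
  (forall m h, (m < N)%N -> G m.+1 h -> G m.+3 (lie y h)) ->
  forall i g, (i <= N)%N -> G i.+1 g ->
  exists a, lcs_eq i.+2 g (a *: iter_ad x y i.+1).
Proof.
move=> xy yG i.
pose A i := [set g | exists a, lcs_eq i.+2 g (a *: iter_ad x y i.+1)].
have sA j : subspace (A j).
  apply/subspaceP; split=> [|c g g' [a aP] [b bP]].
    by exists 0; rewrite scale0r; apply: lcs_eqxx.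
  exists (c * a + b); rewrite scalerDl -scalerA.
  by apply: lcs_eqD => //; apply: lcs_eqZ.
suff AP : (i <= N)%N -> G i.+1 `<=` A i by move=> g /AP; apply.
elim: i => [|i IHi] iN; apply: lcs_sub => // g h Gh.
  have [a [b hE]] := xy h; have [a' [b' gE]] := generating_lie g xy Gh.
  exists (a' * b - b' * a); apply: lcs_eq_trans gE _.
  rewrite scalerBl -!scalerA; apply: lcs_eqD.
    apply: lcs_eqZ; have := lcs_eq_lie x hE.
    by rewrite lieDr !lieZr liexx scaler0 add0r.
  rewrite -scalerN; apply: lcs_eqZ; have := lcs_eq_lie y hE.
  by rewrite lieDr !lieZr liexx scaler0 addr0 (lieC y x) scalerN.
have [c hE] := IHi (ltnW iN) h Gh; have [a [b gE]] := generating_lie g xy Gh.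
exists (a * c); apply: lcs_eq_trans gE _.
rewrite -[X in lcs_eq _ _ X]addr0; apply: lcs_eqD.
  by rewrite -scalerA; apply: lcs_eqZ; have := lcs_eq_lie x hE; rewrite lieZr.
by apply/lcs_eq0; apply: lcsZ; apply: yG.
Qed.

Lemma iter_ad_lie x y i z : lie (iter_ad x y i.+1) z =
  lie x (lie (iter_ad x y i) z) - lie (iter_ad x y i) (lie x z).
Proof. by rewrite /iter_ad /= [lie x (lie _ z)]lie_derivation addrK. Qed.

(** * A possible first failure of [y] to move two steps down *)

Section Jump.
Variables (x y : L) (n : nat).
Hypothesis xy : generating x y.
Hypothesis yG : forall m h, (m < n.+1)%N -> G m.+1 h -> G m.+3 (lie y h).
Local Notation v := (iter_ad x y).
Let N := n.+2.
Hypothesis xvN : G N.+2 (lie x (v N)).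
Let z := lie y (v N).
Let u := lie x z.

Let vy m : (m < n.+1)%N -> G m.+3 (lie y (v m.+1)).
Proof. by move=> mn; apply: yG => //; apply: iter_ad_lcs. Qed.

(* The brackets of the [v i], i > 0, vanish below degree N, are [+- z] in degree
   N and multiples of [u] in degree N + 1.  There skew-symmetry forces [u] to
   vanish, and then [z] generates nothing in the next quotient. *)
Let lie_low i j : (i + j + 3 <= N)%N -> G (i + j).+4 (lie (v i.+1) (v j.+1)).
Proof.
elim: i j => [|i IHi] j ijN; rewrite iter_ad_lie; apply: lcsB.
- apply: lcs_lie; apply: (@vy j); rewrite /N in ijN; lia.
- apply: (@vy j.+1); rewrite /N in ijN; lia.
- by apply: lcs_lie; apply: IHi; lia.
- by have := IHi j.+1; rewrite (addnS i); apply; lia.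
Qed.

Let lie_mid i j : (i + j + 2)%N = N ->
  lcs_eq N.+2 (lie (v i.+1) (v j.+1)) ((-1) ^+ i.+1 *: z).
Proof.
elim: i j => [|i IHi] j ijN; rewrite iter_ad_lie exprS mulN1r
    scaleNr -[X in lcs_eq _ _ X]sub0r; apply: lcs_eqB.
- apply/lcs_eq0; have -> : N.+2 = j.+4 by lia.
  by apply: lcs_lie; apply: (@vy j); rewrite /N in ijN; lia.
- have -> : lie (v 0) (lie x (v j.+1)) = z by rewrite /z (_ : N = j.+2) //; lia.
  by rewrite expr0 scale1r; apply: lcs_eqxx.
- apply/lcs_eq0; have -> : N.+2 = (i + j).+4.+1 by lia.
  by apply: lcs_lie; apply: lie_low; lia.
- by apply: (IHi j.+1); lia.
Qed.

Let lie_high i j : (i + j + 1)%N = N ->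
  lcs_eq N.+3 (lie (v i.+1) (v j.+1)) ((-1) ^+ i *: (i.+1%:R *: u)).
Proof.
elim: i j => [|i IHi] j ijN; rewrite iter_ad_lie.
  rewrite expr0 !scale1r -[u]subr0 (_ : j.+1 = N); last by lia.
  apply: lcs_eqB; first exact: lcs_eqxx.
  by apply/lcs_eq0; apply: lcs_lie.
have -> : (-1) ^+ i.+1 *: (i.+2%:R *: u)
    = (-1) ^+ i.+1 *: u - (-1) ^+ i *: (i.+1%:R *: u).
  rewrite -[i.+2%:R]natr1 scalerDl scale1r scalerDr addrC exprS mulN1r.
  by rewrite !scaleNr.
apply: lcs_eqB; last by apply: (IHi j.+1); lia.
by have := lcs_eq_lie x (lie_mid (i := i) (j := j) ltac:(lia)); rewrite lieZr.
Qed.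

Lemma no_jump : G N.+2 z.
Proof.
have Gz : G N.+1 z by apply: lcs_lie; apply: iter_ad_lcs.
have Gu : G N.+3 u.
  (* [lie_high] evaluates both [v_N, v_1] and [v_1, v_N]; their sum 0 is this coefficient times [u].
     It is nonzero since N > 1 in characteristic zero. *)
  have c0 : (-1) ^+ n.+1 * N%:R + 1 != 0 :> F.
    rewrite -signr_odd; case: (odd _); last first.
      by rewrite expr0 mul1r natr1 natr_neq0.
    rewrite expr1 mulN1r -[N%:R]natr1 opprD subrK oppr_eq0 natr_neq0 //.
  have := lie_high (i := n.+1) (j := 0) ltac:(rewrite /N; lia).
  have := lie_high (i := 0) (j := n.+1) ltac:(rewrite /N; lia).
  rewrite expr0 !scale1r scalerA => e1 e2; have := lcs_eqN e1.
  rewrite -lieC => /lcs_eqC/lcs_eq_trans/(_ e2) /lcs_eqC.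
  rewrite /lcs_eq opprK -[X in _ + X]scale1r -scalerDl .
  move/(lcsZ ((-1) ^+ n.+1 * N%:R + 1)^-1).
  by rewrite scalerA mulVf // scale1r.
(* Up to sign, [z] is [v_1, v_(n+1)] by [lie_mid], and ad y moves each factor two steps down. *)
have Gyz : G N.+3 (lie y z).
  have := lcs_eq_lie y (lie_mid (i := 0) (j := n) ltac:(rewrite /N; lia)).
  rewrite expr1 scaleN1r linearN => /lcs_eqC/lcs_eq_mem yz.
  rewrite -[lie y z]opprK; apply: lcsN; apply: yz.
  rewrite lie_derivation.
  apply: lcsD.
    exact: (lcs_lie_add (vy (ltn0Sn n)) (iter_ad_lcs x y n.+1)).
  have := lcs_lie_add (iter_ad_lcs x y 1) (vy (ltnSn n)); rewrite add1n; exact.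
(* Otherwise [z] would span its quotient while both [x, z] and [y, z] vanish in the next one, which
   would then be zero. *)
have [//|nGz] := pselect (G N.+2 z); case: (@lcs_proper N.+1).
apply: lcs_sub => [|g h Gh]; first exact: subspace_lcs.
have [c /(lcs_eq_lie g) hE] := lcs_line Gz nGz Gh; apply: lcs_eq_mem hE _.
rewrite lieZr; apply: lcsZ; have [a [b gE]] := generating_lie g xy Gz.
by apply: lcs_eq_mem gE _; apply: lcsD; apply: lcsZ.
Qed.
End Jump.

(** At a first failure, [y, w] spans its quotient, so some [x = s - mu *: y] kills [w] there. The
    pair [x], [y] still spans modulo [G 1], [w] is proportional to an iterate of ad x, and [no_jump]
    applies. *)
Lemma two_step_centralizer s y : generating s y ->
  (forall h, G 1 h -> G 3 (lie y h)) ->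
  forall n h, G n.+1 h -> G n.+3 (lie y h).
Proof.
move=> sy y1; elim/ltn_ind => -[//|n] yG w Gw.
have {}yG m h : (m < n.+1)%N -> G m.+1 h -> G m.+3 (lie y h).
  by move=> mn; apply: yG.
have [//|nz] := pselect (G n.+4 (lie y w)); exfalso.
have Gz : G n.+3 (lie y w) by apply: lcs_lie.
have [mu muP] := lcs_line Gz nz (lcs_lie s Gw).
pose x := s - mu *: y.
have xy : generating x y.
  move=> g; have [a [b gE]] := sy g; exists a, (b + a * mu).
  suff -> : a *: x + (b + a * mu) *: y = a *: s + b *: y by [].
  by rewrite /x scalerBr scalerDl scalerA [b *: y + _]addrC addrA subrK.
have gen := iter_ad_gen xy yG.
have [a aP] := gen _ w (leqnn _) Gw.
have xw : G n.+4 (lie x w) by rewrite lieDl -scaleNr lieZl scaleNr.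
have a0 : a != 0.
  apply/eqP => a0; apply: nz; apply: lcs_lie.
  by apply: lcs_eq_mem aP _; rewrite a0 scale0r; apply: lcs0.
have vE : lcs_eq n.+3 (iter_ad x y n.+2) (a^-1 *: w).
  by have := lcs_eqZ a^-1 (lcs_eqC aP); rewrite scalerA mulVf // scale1r.
apply: nz; apply: (lcs_eq_mem (lcs_eq_lie y aP)); rewrite lieZr; apply: lcsZ.
apply: no_jump xy yG _; apply: (lcs_eq_mem (lcs_eq_lie x vE)).
by rewrite lieZr; apply: lcsZ.
Qed.

End MaximalClass.

(** * Graded algebras *)

Section Graded.
Variables (F : fieldType) (L : lieAlgType F) (gr : nat -> set L).
Hypothesis grP : positive_grading gr.
Notation G := (@lcs F L).
Implicit Types (x y z : L) (f : nat -> L).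

Lemma grading_decomposition x : exists f,
  (forall i, gr i (f i)) /\
  exists n, (forall i, (n <= i)%N -> f i = 0) /\ x = \sum_(i < n) f i.
Proof.
have [n [y [yP ->]]] := grading_span grP x.
(* Truncation is needed because [grading_span] leaves [y] arbitrary from [n] on. *)
exists (fun i => if (i < n)%N then y i else 0); split=> [i|].
  by case: ifP => // _; apply: subspace0; apply: grading_subspace.
exists n; split=> [i ni|]; first by rewrite ltnNge ni.
by apply: eq_bigr => i _; rewrite ltn_ord.
Qed.

(** A decomposition is picked by choice; [component_unique] makes the choice immaterial. *)
Definition component i x : L := sval (cid (grading_decomposition x)) i.

Lemma component_gr x i : gr i (component i x).
Proof. by rewrite /component; case: cid => f []. Qed.

Lemma component_sum x : exists n,
  (forall i, (n <= i)%N -> component i x = 0) /\ x = \sum_(i < n) component i x.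
Proof. by rewrite /component; case: cid => f []. Qed.

Lemma component_unique x f n : (forall i, gr i (f i)) ->
    (forall i, (n <= i)%N -> f i = 0) -> x = \sum_(i < n) f i ->
  component^~ x = f.
Proof.
move=> fP f0 xE; have [m [c0 xE']] := component_sum x.
have widen k h N : (k <= N)%N -> (forall i, (k <= i)%N -> h i = 0) ->
    \sum_(i < k) h i = \sum_(i < N) h i :> L.
  move=> kN h0; rewrite (big_ord_widen N h) // big_mkcond.
  by apply: eq_bigr => i _; case: ltnP => // /h0.
pose N := maxn n m.
have nN : (n <= N)%N by rewrite leq_maxl.
have mN : (m <= N)%N by rewrite leq_maxr.
apply/funext => i; apply/eqP; rewrite -subr_eq0; apply/eqP.
have [iN|Ni] := ltnP i N; last first.
  by rewrite c0 ?f0 ?subr0 //; apply: leq_trans Ni.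
apply: (grading_direct grP (n := N) (y := fun i => component i x - f i)) => //.
  move=> j; apply: subspaceB; first exact: grading_subspace.
    exact: component_gr.
  exact: fP.
by rewrite sumrB -(widen m _ N mN c0) -(widen n _ N nN f0) -xE -xE' subrr.
Qed.

Lemma component_linear i a x y :
  component i (a *: x + y) = a *: component i x + component i y.
Proof.
have [n [x0 xE]] := component_sum x; have [m [y0 yE]] := component_sum y.
have gr_sub j : subspace (gr j) by apply: grading_subspace.
pose h i := a *: component i x + component i y.
suff /(congr1 (fun h => h i)) : component^~ (a *: x + y) = h by [].
pose N := maxn n m.
apply: (@component_unique _ _ N).
- move=> j; apply: subspaceD => //; last exact: component_gr.
  by apply: subspaceZ => //; apply: component_gr.
- move=> j Nj; rewrite /h x0 ?y0 ?scaler0 ?addr0 //.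
    exact: leq_trans (leq_maxr _ _) Nj.
  exact: leq_trans (leq_maxl _ _) Nj.
have E k z : (k <= N)%N -> (forall i, (k <= i)%N -> component i z = 0) ->
    z = \sum_(i < k) component i z -> z = \sum_(i < N) component i z.
  move=> kN z0 zE; rewrite {1}zE (big_ord_widen N (component^~ z)) //.
  rewrite big_mkcond.
  by apply: eq_bigr => j _; case: ltnP => // /z0.
rewrite big_split /= -scaler_sumr -(E n) ?leq_maxl // -(E m) ?leq_maxr //.
Qed.

HB.instance Definition _ i := GRing.isLinear.Build F L L *:%R
  (component i) (component_linear i).

Lemma component_sub i x y : component i (x - y) = component i x - component i y.
Proof. exact: (linearB (component i)). Qed.

Lemma component_homogeneous d x i : gr d x ->
  component i x = if i == d then x else 0.
Proof.
move=> xd; suff /(congr1 (fun h => h i)) :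
    component^~ x = fun i => if i == d then x else 0 by [].
apply: (@component_unique _ _ d.+1).
- move=> j; case: eqP => [->//|_]; apply: subspace0.
  exact: grading_subspace.
- by move=> j dj; rewrite gtn_eqF.
rewrite big_ord_recr /= eqxx big1 ?add0r // => j _.
by rewrite ltn_eqF.
Qed.

(** A bracket of n+1 homogeneous elements has degree at least n+1, because degrees are positive. *)
Lemma component_lcs n x i : G n x ->
  G n (component i x) /\ ((i <= n)%N -> component i x = 0).
Proof.
have gr0 x0 : gr 0%N x0 -> x0 = 0 by rewrite (grading0 grP).
move: x i; elim: n => [|n IHn] x i Gx.
  split=> [|]; first by [].
  by rewrite leqn0 => /eqP ->; apply/gr0/component_gr.
pose A := [set x | forall i, G n.+1 (component i x)
  /\ ((i <= n.+1)%N -> component i x = 0)].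
have sA : subspace A.
  apply/subspaceP; split=> [j|a y z Ay Az j].
    by rewrite (linear0 (component j)); split=> //; apply: lcs0.
  have [Gy y0] := Ay j; have [Gz z0] := Az j; rewrite component_linear.
  split=> [|jn]; first by apply: lcsD => //; apply: lcsZ.
  by rewrite y0 // z0 // scaler0 addr0.
suff /(_ x Gx i) : G n.+1 `<=` A by [].
apply: lcs_sub => // y z Gz.
have [k [_ yE]] := component_sum y; have [m [_ zE]] := component_sum z.
rewrite yE lie_suml; apply: subspace_sum => // j _.
rewrite zE linear_sum; apply: subspace_sum => // l _ /=.
have [Gzl z0] := IHn z l Gz; move=> d.
rewrite (component_homogeneous d (d := j + l)); last first.
  by apply: grading_lie => //; apply: component_gr.
case: eqP => [->|_]; last by split=> //; apply: lcs0.
split=> [|jln]; first exact: lcs_lie.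
case: (posnP j) jln => [->|j0] jln.
  by rewrite (gr0 (component 0 y)) ?lie0l //; apply: component_gr.
by rewrite z0 ?linear0 //; lia.
Qed.

Hypothesis F0 : [pchar F] =i pred0.
Hypothesis dimG0 : quotient_dim (G 0) (G 1) 2.
Hypothesis dimG : forall n, quotient_dim (G n.+1) (G n.+2) 1.
Hypothesis genL : generates (gr 1%N `|` gr 3%N).

Lemma not_cyclic v : ~ forall x, exists a, G 1 (x - a *: v).
Proof.
by move/lcs_cyclic => G12; apply: (lcs_proper dimG (n := 0)); rewrite G12.
Qed.

(** The sums in question contain [G 1], hence all brackets, and so form a subalgebra containing the
    generators. *)
Lemma generated_decomposition x :
  exists a b, gr 1%N a /\ gr 3%N b /\ lcs_eq 1 x (a + b).
Proof.
have gr_sub j : subspace (gr j) by apply: grading_subspace.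
pose S := [set x | exists a b, gr 1%N a /\ gr 3%N b /\ lcs_eq 1 x (a + b)].
suff SP : smallest (@lie_subalgebra F L) (gr 1%N `|` gr 3%N) `<=` S.
  by apply: (SP x); rewrite genL.
apply: smallest_sub.
  split=> [|y z _ _]; last first.
    exists 0, 0; split; first exact: subspace0.
    split; first exact: subspace0.
    by rewrite addr0; apply/lcs_eq0; apply: lcs_lie.
  apply/subspaceP; split=> [|c y z [a [b [ya [yb yE]]]] [a' [b' [za [zb zE]]]]].
    exists 0, 0; split; first exact: subspace0.
    by split; [exact: subspace0 | rewrite addr0; apply: lcs_eqxx].
  exists (c *: a + a'), (c *: b + b'); split.
    by apply: subspaceD => //; apply: subspaceZ.
  split; first by apply: subspaceD => //; apply: subspaceZ.
  rewrite addrACA -scalerDr; apply: lcs_eqD => //; exact: lcs_eqZ.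
move=> y [y1|y3].
  exists y, 0; split=> //; split; first exact: subspace0.
  by rewrite addr0; apply: lcs_eqxx.
exists 0, y; split; first exact: subspace0.
by split=> //; rewrite add0r; apply: lcs_eqxx.
Qed.

(** Homogeneous elements of degrees 1 and 3 span L modulo [G 1], so two of them give a basis of the
    quotient. Their degrees may coincide. *)
Lemma homogeneous_generators : exists p q s t,
  [/\ p = 1%N \/ p = 3%N, q = 1%N \/ q = 3%N, gr p s, gr q t
    & generating s t].
Proof.
have H1 s : ~ (forall i y, i = 1%N \/ i = 3%N -> gr i y ->
    exists a, G 1 (y - a *: s)).
  move=> Hs; apply: (@not_cyclic s) => x.
  have [a [b [a1 [b3 xE]]]] := generated_decomposition x.
  have [c cE] := Hs 1%N a (or_introl erefl) a1.
  have [d dE] := Hs 3%N b (or_intror erefl) b3.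
  by exists (c + d); apply: lcs_eq_trans xE _; rewrite scalerDl; apply: lcs_eqD.
have [p [s [pP sp nGs]]] : exists p s,
    [/\ p = 1%N \/ p = 3%N, gr p s & ~ G 1 s].
  apply: contrapT => nex; apply: (@H1 0) => i y iP yi; exists 0.
  by rewrite scaler0 subr0; apply: contrapT => nGy; apply: nex; exists i, y.
have [q [t [qP tq nGt]]] : exists q t,
    [/\ q = 1%N \/ q = 3%N, gr q t & forall a, ~ G 1 (t - a *: s)].
  apply: contrapT => nex; apply: (@H1 s) => i y iP yi.
  apply: contrapT => nGy; apply: nex; exists i, y; split=> // a Ga.
  by apply: nGy; exists a.
exists p, q, s, t; split=> // z.
have [|a [b ab]] := quotient_dim2 (@subspace_lcs F L 0) (@subspace_lcs F L 1)
  dimG0 (s := s) (t := t) I I nGs nGt (z := z).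
  by [].
by exists a, b; rewrite /lcs_eq opprD addrA.
Qed.

Lemma generatingC x y : generating x y -> generating y x.
Proof. by move=> xy z; have [a [b]] := xy z; exists b, a; rewrite addrC. Qed.

Lemma generating_lcs1 x y g : generating x y -> G 1 g ->
  exists a, lcs_eq 2 g (a *: lie x y).
Proof. by move=> xy Gg; apply: (@iter_ad_gen F L x y 0 xy _ 0 g). Qed.

(** If neither [s] nor [t] serves as [y], then [s, [s, t]] is congruent to mu [t, [s, t]]. For equal
    degrees [s - mu *: t] is homogeneous and serves; for distinct ones, taking components of this
    congruence puts [s, [s, t]] in [G 3], a contradiction. *)
Lemma central_homogeneous_generators : exists p q x y,
  [/\ p = 1%N \/ p = 3%N, q = 1%N \/ q = 3%N, gr p x, gr q y
    & generating x y /\ G 3 (lie y (lie x y))].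
Proof.
have [p [q [s [t [pP qP sp tq st]]]]] := homogeneous_generators.
have [Gt|nGt] := pselect (G 3 (lie t (lie s t))); first by exists p, q, s, t.
have [Gs|nGs] := pselect (G 3 (lie s (lie s t))).
  exists q, p, t, s; split=> //; split; first exact: generatingC.
  by rewrite (lieC t) linearN; apply: lcsN.
have Gst : G 1 (lie s t) by apply: lcs_lie.
have [mu muP] := lcs_line dimG (lcs_lie t Gst) nGt (lcs_lie s Gst).
have [pq|pq] := eqVneq p q.
  exists q, p, t, (s - mu *: t); split=> //.
    rewrite pq in sp *; apply: subspaceB => //; first exact: grading_subspace.
    by apply: subspaceZ => //; apply: grading_subspace.
  split=> [z|].
    have [a [b zE]] := st z; exists (b + a * mu), a.
    suff -> : (b + a * mu) *: t + a *: (s - mu *: t) = a *: s + b *: t by [].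
    by rewrite scalerBr scalerDl scalerA addrC [b *: t + _]addrC addrA subrK.
  have -> : lie t (s - mu *: t) = - lie s t.
    by rewrite linearB linearZ /= liexx scaler0 subr0 lieC.
  rewrite linearN /=.
  by apply: lcsN; rewrite -scaleNr lieDl lieZl scaleNr.
case: nGs; have [+ _] := component_lcs (p + (p + q)) muP.
have sw : gr (p + (p + q)) (lie s (lie s t)).
  by apply: grading_lie => //; apply: grading_lie.
have tw : gr (q + (p + q)) (lie t (lie s t)).
  by apply: grading_lie => //; apply: grading_lie.
rewrite component_sub linearZ /=.
rewrite (component_homogeneous _ sw) (component_homogeneous _ tw) eqxx.
by rewrite eqn_add2r (negPf pq) scaler0 subr0.
Qed.

(** Indexed like the powers ['X^k] in a table algebra: [x] takes the place of e_1 and [v k] that of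
    e_(k+3). *)
Definition family_cons x (v : nat -> L) k := if k is k'.+1 then v k' else x.

(** * The homogeneous basis formed by x and the iterates of ad x on y *)

Section Basis.
Variables (p q : nat) (x y : L).
Hypothesis pP : p = 1%N \/ p = 3%N.
Hypothesis qP : q = 1%N \/ q = 3%N.
Hypothesis xp : gr p x.
Hypothesis yq : gr q y.
Hypothesis xy : generating x y.
Hypothesis yxy : G 3 (lie y (lie x y)).
Local Notation v := (iter_ad x y).

Local Notation u := (family_cons x v).
Definition basis_degree k := if k is k'.+1 then (k' * p + q)%N else p.

Lemma basis_family_gr k : gr (basis_degree k) (u k).
Proof.
case: k => [//|k] /=; elim: k => [//|k IHk]; rewrite mulSn -addnA.
exact: grading_lie.
Qed.

Lemma basis_family_lcs k : G k (u k.+1).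
Proof. exact: iter_ad_lcs. Qed.

Lemma lie_y_lcs n h : G n.+1 h -> G n.+3 (lie y h).
Proof.
apply: (two_step_centralizer F0 dimG xy) => g /(generating_lcs1 xy)[a aP].
by apply: lcs_eq_mem (lcs_eq_lie y aP) _; rewrite lieZr; apply: lcsZ.
Qed.

Lemma basis_family_gen i g : G i.+1 g -> exists a, lcs_eq i.+2 g (a *: u i.+2).
Proof. by apply: (iter_ad_gen xy (N := i)) => // m h _; apply: lie_y_lcs. Qed.

Lemma basis_family_proper i : ~ G i.+2 (u i.+2).
Proof.
move=> Gu; apply: (lcs_proper dimG (n := i)) => g /basis_family_gen[a aP].
by apply: lcs_eq_mem aP _; apply: lcsZ.
Qed.

Lemma generating_free a b : G 1 (a *: x + b *: y) -> a = 0 /\ b = 0.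
Proof.
have aux (c d : F) (s t : L) : generating s t -> G 1 (c *: s + d *: t) -> c = 0.
  move=> st Gst; apply/eqP/negPn/negP => c0; apply: (@not_cyclic t) => z.
  have [e [f zE]] := st z; exists (f - e / c * d); apply: lcs_eq_trans zE _.
  have := lcsZ (e / c) Gst; rewrite scalerDr !scalerA divfK //.
  by rewrite /lcs_eq scalerBl opprB addrA addrAC addrK.
move=> Gab; split; first exact: aux xy Gab.
by apply: (aux _ a _ x (generatingC xy)); rewrite addrC.
Qed.

Lemma basis_family_span_mod n z : exists c, lcs_eq n z (lincomb u c).
Proof.
elim: n z => [|[|n] IHn] z; first by exists 0.
  have [a [b zE]] := xy z; exists (a *: 'X^0 + b *: 'X^1).
  by rewrite linearD !linearZ /= !lincombXn.
have [c cE] := IHn z; have [a aE] := basis_family_gen cE.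
exists (c + a *: 'X^(n.+2)); rewrite linearD linearZ /= lincombXn addrC.
by have := lcs_eqD aE (lcs_eqxx n.+2 (lincomb u c)); rewrite subrK.
Qed.

Lemma component_lincomb d c : component d (lincomb u c) =
  \sum_(k < size c | basis_degree k == d) c`_k *: u k.
Proof.
rewrite /lincomb linear_sum [RHS]big_mkcond; apply: eq_bigr => k _.
rewrite linearZ /=.
rewrite (component_homogeneous d (basis_family_gr k)) eq_sym.
by case: eqP => _ //; rewrite scaler0.
Qed.

(** A component of degree [n] is a combination of the family modulo [G n]; taking degree [n] parts
    removes the error, by [component_lcs]. *)
Lemma basis_family_span z : exists c, z = lincomb u c.
Proof.
have [n [_ ->]] := component_sum z; elim: n => [|n [c cE]].
  by exists 0; rewrite big_ord0 linear0.
rewrite big_ord_recr cE /=.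
have [c' c'E] := basis_family_span_mod n (component n z).
have [_ /(_ (leqnn n))] := component_lcs n c'E.
rewrite component_sub (component_homogeneous n (component_gr z n)) eqxx.
move=> /eqP; rewrite subr_eq0 component_lincomb => /eqP ->.
exists (c + \sum_(k < size c' | basis_degree k == n) c'`_k *: 'X^k).
rewrite linearD linear_sum; congr (_ + _); apply: eq_bigr => k _.
by rewrite linearZ /= lincombXn.
Qed.

(** The family is triangular for the series: [u 0] and [u 1] are independent modulo [G 1], and
    [u k.+2] lies in [G k.+1] but not in [G k.+2]. *)
Lemma lincomb_lcs n c : G n.+1 (lincomb u c) ->
  forall k, (k < n.+2)%N -> c`_k = 0.
Proof.
elim: n => [|n IHn] Gc.
  move: Gc; rewrite (@lincombE _ _ u (size c).+2); last first.
    by rewrite -addn2 leq_addr.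
  rewrite !big_ord_recl /= addrA => Gc.
  set R := \sum_(i < _) _ in Gc; have GR : G 1 R.
    apply: subspace_sum => [|i _]; first exact: subspace_lcs.
    by apply: lcsZ; apply: (lcs_decr (ltn0Sn i) (iter_ad_lcs x y i.+1)).
  have := lcsB Gc GR; rewrite addrK => /generating_free[c0 c1].
  by case=> [|[]].
have {}IHn := IHn (lcs_decrS Gc); move=> k; rewrite ltnS leq_eqVlt.
case/orP=> [/eqP -> {k}|/IHn //].
have [n_c|c_n] := ltnP n.+2 (size c); last by rewrite nth_default.
move: Gc; rewrite /lincomb (bigD1 (Ordinal n_c)) //= => Gc.
set R := \sum_(i < _ | _) _ in Gc; have GR : G n.+2 R.
  apply: subspace_sum => [|i i_n]; first exact: subspace_lcs.
  have [i_lt|i_gt|i_eq] := ltngtP i n.+2.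
  - by rewrite IHn // scale0r; apply: lcs0.
  - case: (i : nat) i_gt => // j nj; apply: lcsZ.
    by rewrite ltnS in nj; apply: (lcs_decr nj (basis_family_lcs j)).
  - by move: i_n; rewrite -val_eqE /= i_eq eqxx.
have := lcsB Gc GR; rewrite addrK => Gu; apply/eqP/negPn/negP => cn.
apply: (@basis_family_proper n); have := lcsZ (c`_n.+2)^-1 Gu.
by rewrite scalerA mulVf // scale1r.
Qed.

Lemma basis_family_free c : lincomb u c = 0 -> c = 0.
Proof.
move=> c0; apply/polyP => k; rewrite coef0.
by apply: (@lincomb_lcs k) => //; rewrite c0; apply: lcs0.
Qed.

(** [y, v_(n+1)] lies in [G n.+3], so only [u k] with k >= n+4 occur in it. Equality of degrees
    reads (k-n-2) p = q; with [p] and [q] in {1, 3} this forces p = 1, q = 3 and k = n+5, and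
    otherwise the bracket is 0. *)
Lemma lie_y_basis n : exists a, lie y (v n) = a *: v n.+3.
Proof.
case: n => [|n]; first by exists 0; rewrite liexx scale0r.
have [c cE] := basis_family_span (lie y (v n.+1)).
have Gc : G n.+3 (lincomb u c).
  by rewrite -cE; apply: lie_y_lcs; apply: iter_ad_lcs.
have dE : gr (n.+1 * p + q + q) (lie y (v n.+1)).
  by rewrite addnC; exact: (grading_lie grP yq (basis_family_gr n.+2)).
have := component_homogeneous (n.+1 * p + q + q) dE; rewrite eqxx => <-.
rewrite cE component_lincomb.
have term0 k : basis_degree k == (n.+1 * p + q + q)%N -> k != n.+4.+1 ->
    c`_k = 0.
  move=> /eqP dk nk; have [kn|nk'] := ltnP k n.+4.
    exact: (lincomb_lcs Gc).
  have [j jE] : exists j, k = (n.+2 + j.+2)%N by exists (k - n.+4)%N; lia.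
  by move: dk nk; rewrite jE /=; case: pP => ->; case: qP => ->; lia.
have [/andP[n_c dn]|nn] :=
    boolP ((n.+4.+1 < size c)%N
      && (basis_degree n.+4.+1 == (n.+1 * p + q + q)%N)).
  exists c`_n.+4.+1; rewrite (bigD1 (Ordinal n_c)) //= big1 ?addr0 //.
  by move=> i /andP[di ni]; rewrite term0 ?scale0r.
exists 0; rewrite scale0r big1 // => i di; rewrite term0 ?scale0r //.
by apply: contraNneq nn => <-; rewrite ltn_ord.
Qed.

End Basis.

Lemma graded_structure : exists (x : L) (v : nat -> L) (a : nat -> F),
  [/\ forall n, lie x (v n) = v n.+1,
      forall n, lie (v 0%N) (v n) = a n *: v n.+3,
      forall z, exists c, z = lincomb (family_cons x v) c
    & forall c, lincomb (family_cons x v) c = 0 -> c = 0].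
Proof.
have [p [q [x [y [pP qP xp yq [xy yxy]]]]]] := central_homogeneous_generators.
have [a aP] := boolp.choice (lie_y_basis pP qP xp yq xy yxy).
exists x, (iter_ad x y), a; split=> //.
  exact: (basis_family_span xp yq xy yxy).
exact: basis_family_free xy yxy.
Qed.

End Graded.

(** * From the structure constants to the three algebras *)

Section Assembly.
Variables (F : fieldType) (L : lieAlgType F) (x : L) (v : nat -> L).
Variable a : nat -> F.
Hypothesis xv : forall n, lie x (v n) = v n.+1.
Hypothesis vv : forall n, lie (v 0%N) (v n) = a n *: v n.+3.
Hypothesis spanP : forall z, exists c, z = lincomb (family_cons x v) c.
Hypothesis freeP : forall c, lincomb (family_cons x v) c = 0 -> c = 0.
Implicit Types (c : {poly F}) (m n k : nat).

Lemma lincomb_scale (u : nat -> L) (l : nat -> F) c :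
  lincomb (fun k => l k *: u k) c = lincomb u (\poly_(k < size c) (c`_k * l k)).
Proof.
rewrite (lincombE u (size_poly _ _)); apply: eq_bigr => k _.
by rewrite coef_poly ltn_ord scalerA.
Qed.

Lemma family_neq0 n : v n != 0.
Proof.
apply/eqP => vn0; have := freeP (c := 'X^(n.+1)).
by rewrite lincombXn /= => /(_ vn0)/eqP; rewrite -size_poly_eq0 size_polyXn.
Qed.

Lemma family_scalerI n (c d : F) : c *: v n = d *: v n -> c = d.
Proof.
move/eqP; rewrite -subr_eq0 -scalerBl scaler_eq0 (negPf (family_neq0 n)) orbF.
by rewrite subr_eq0 => /eqP.
Qed.

Fixpoint structure_coef m n : F :=
  if m is m'.+1 then structure_coef m' n - structure_coef m' n.+1 else a n.

Lemma lie_family m n : lie (v m) (v n) = structure_coef m n *: v (m + n + 3)%N.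
Proof.
elim: m n => [|m IHm] n /=; first by rewrite vv addn3.
rewrite -xv.
have -> : lie (lie x (v m)) (v n)
    = lie x (lie (v m) (v n)) - lie (v m) (v n.+1).
  by rewrite lie_derivation !xv addrK.
by rewrite !IHm lieZr xv scalerBl !addn3 addnS addSn.
Qed.

Lemma structure_coef_pascal : pascal structure_coef.
Proof.
split=> [m n|m n]; last by rewrite /= subrK.
apply: (@family_scalerI (m + n + 3)).
by rewrite scaleNr -lie_family -lieC lie_family (addnC n m).
Qed.

Lemma structure_coef_jacobi3 : jacobi3 structure_coef.
Proof.
move=> i j k; apply: (@family_scalerI (i + j + k + 6)).
rewrite scale0r -(lie_jacobi (v i) (v j) (v k)) !lie_family !lieZr !lie_family.
rewrite !scalerA !scalerDl; congr (_ *: v _ + _ *: v _ + _ *: v _); lia.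
Qed.

(** The basis to be matched with the table is e_1 = x, e_(n+3) = l_n v_n; the last two hypotheses
    are its bracket relations. *)
Lemma lie_iso_scaled (t : lie_table) (l : nat -> F) : (forall n, l n != 0) ->
    (forall n, l n = (t 1%N n.+3)%:~R * l n.+1) ->
    (forall m n, l m * l n * structure_coef m n
      = (t m.+3 n.+3)%:~R * l (m + n + 3)%N) ->
  lie_iso L (table_algebra F t).
Proof.
move=> l0 l1 ll; pose l' k := if k is k'.+1 then l k' else 1.
have l'0 k : l' k != 0 by case: k => [|k] /=; rewrite ?oner_eq0.
pose u k := l' k *: family_cons x v k.
apply: (lie_iso_table (u := u)) => [z|c|].
- have [c ->] := spanP z; exists (\poly_(k < size c) (c`_k / l' k)).
  have -> : family_cons x v = fun k => (l' k)^-1 *: u k.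
    by apply/funext => k; rewrite /u scalerA mulVf ?scale1r.
  exact: lincomb_scale.
- rewrite lincomb_scale => /freeP/polyP c0; apply/polyP => k; rewrite coef0.
  have [kc|ck] := ltnP k (size c); last by rewrite nth_default.
  have /eqP := c0 k; rewrite coef_poly kc coef0 mulf_eq0 (negPf (l'0 k)) orbF.
  by move/eqP.
have xu n : lie x (l n *: v n) = (t 1%N n.+3)%:~R *: u n.+2.
  by rewrite lieZr xv /u /= scalerA -l1.
have u0 : u 0%N = x by rewrite /u /= scale1r.
move=> [|m] [|n].
- by rewrite liexx table_alt // scale0r.
- by rewrite u0; apply: xu.
- rewrite u0 lieC [lie x _]xu (@table_skew t 1 m.+3) // rmorphN scaleNr.
  by congr (- (_ *: u _)); rewrite /= addn1.
have -> : (degree_of m.+1 + degree_of n.+1 - 2 = (m + n + 3).+1)%N.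
  by rewrite /=; lia.
by rewrite lieZl lieZr lie_family !scalerA ll.
Qed.

Hypothesis F0 : [pchar F] =i pred0.

Lemma lie_iso_trichotomy :
  [\/ lie_iso L (m03 F), lie_iso L (m3 F) | lie_iso L (W3 F)].
Proof.
have [c0|[c01 [c0n cmn]]|[s s0 cE]] := jacobi3_classification F0
  structure_coef_pascal structure_coef_jacobi3.
- apply: Or31; apply: (@lie_iso_scaled _ (fun=> 1)) => [_|n|m n].
  + by rewrite oner_eq0.
  + by rewrite mulr1.
  + by rewrite c0 mulr0 mul0r.
- have intr1 (z : F) (k : int) : k = 1 -> z = k%:~R * z.
    by move=> ->; rewrite mul1r.
  have intrN1 (z : F) (k : int) : k = -1 -> - z = k%:~R * z.
    by move=> ->; rewrite mulrN1z mulN1r.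
  (* With all scalars equal to [b], the relation for [e_3, e_4] becomes b^2 c(0, 1) = b. *)
  apply: Or32; pose b := (structure_coef 0 1)^-1.
  apply: (@lie_iso_scaled _ (fun=> b)) => [_|n|m n]; first exact: invr_neq0.
    by apply: (intr1 b); case: n.
  have bc (z : F) : z * b * structure_coef 0 1 = z by rewrite /b mulfVK.
  case: m n => [|m] [|n].
  + rewrite pascal_diag //; last exact: structure_coef_pascal.
    by rewrite mulr0 mul0r.
  + by rewrite c0n bc; apply: (intr1 b).
  + by rewrite structure_coef_pascal.1 c0n mulrN bc; apply: (intrN1 b).
  + by rewrite cmn mulr0 mul0r.
apply: Or33; have fn0 n : n`!%:R != 0 :> F by apply: natr_fact_neq0.
have WE i j : (W3_table i j)%:~R = j%:R - i%:R :> F by rewrite /= rmorphB.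
(* The relation [e_1, e_(n+3)] = (n+2) e_(n+4) forces l_n = (n+2) l_(n+1), hence the factorials; 1/s
   absorbs the factor of [witt_coef s]. *)
apply: (@lie_iso_scaled _ (fun n => (s * n.+1`!%:R)^-1)) => [n|n|m n].
- by rewrite invr_neq0 // mulf_neq0.
- rewrite WE [in RHS]factS natrM; have := fn0 n.+1; 
  have : 2 + n%:R != 0 :> F by rewrite -natrD natr_neq0.
  by move: (n.+1`!%:R) => w n2 w0; field; rewrite n2 w0 s0.
- rewrite WE cE /witt_coef (_ : (m + n + 3).+1 = (m + n).+4)%N; last by lia.
  have := fn0 m.+1; have := fn0 n.+1; have := fn0 (m + n).+4.
  move: (_`!%:R) (_`!%:R) (_`!%:R) => w1 w2 w3 w10 w20 w30.
  by rewrite -!natr1; field; rewrite w10 w20 w30 s0.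
Qed.
End Assembly.

Theorem theorem3p27 (F : closedFieldType) (charF0 : [pchar F] =i pred0)
    (g : lieAlgType F) (gr : nat -> set g) :
  positive_grading gr ->
  infinite_dimensional g ->
  maximal_class g ->
  generates (gr 1%N `|` gr 3%N) ->
  [\/ lie_iso g (m03 F), lie_iso g (m3 F) | lie_iso g (W3 F)].
Proof.
move=> grP _ gmax ggen; have [dim0 dimS] := maximal_class_dims gmax.
have [x [v [a [xv vv uspan ufree]]]] :=
  graded_structure grP charF0 dim0 dimS ggen.
exact: lie_iso_trichotomy xv vv uspan ufree charF0.
Qed.
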